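(* Let $B$ be a $C^*$-algebra and let $S$ and $T$ be weakly commuting (regular self-adjoint) operators on a Hilbert $B$-module $E$. Then there is a constant $\lambda_0>0$ such that the operators $$\lambda^2\big[S,(S+\lambda)^{-1}(T+\lambda)^{-1}\big]_- \quad\text{and}\quad \lambda^2\big[T,(S+\lambda)^{-1}(T+\lambda)^{-1}\big]_-$$ are uniformly bounded for $\lambda\in i\mathbb{R}$, $|\lambda|\geq\lambda_0$, and converge strongly to zero as $\lambda\to\pm i\infty$.
   Context: For operators $X,Y$, $[X,Y]_-:=XY-YX$. The commutators of $S$ (resp. $T$) with the bounded operator $(S+\lambda)^{-1}(T+\lambda)^{-1}$ are initially defined on $\mathrm{Dom}\,S$ (resp. $\mathrm{Dom}\,T$); the assertion means that they are bounded there, and it refers to their bounded extensions to $E$. Let $S,T$ be regular self-adjoint operators on a Hilbert $B$-module $E$ with $\mathrm{Dom}\,S\cap\mathrm{Dom}\,T$ dense. For $x,y\in\mathrm{Dom}\,S\cap\mathrm{Dom}\,T$ put $$\langle x|y\rangle_{S,T}:=\langle x|y\rangle+\langle Sx|Sy\rangle+\langle Tx|Ty\rangle .$$ The commutator $[S,T]_-=ST-TS$ has the natural initial domain $$\mathrm{Dom}([S,T]_-)=\{x\in\mathrm{Dom}\,S\cap\mathrm{Dom}\,T: Sx\in\mathrm{Dom}\,T \text{ and } Tx\in\mathrm{Dom}\,S\}.$$ The operators $S$ and $T$ are called weakly commuting if: (1) there is a constant $C>0$ such that $\langle [S,T]_-x\,|\,[S,T]_-x\rangle\leq C\langle x|x\rangle_{S,T}$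 for all $x\in\mathrm{Dom}([S,T]_-)$; (2) there are a core $\mathcal{E}\subset\mathrm{Dom}\,T$ for $T$ and a constant $\lambda_0'>0$ such that $(S+\lambda)^{-1}(\mathcal{E})\subset\mathrm{Dom}([S,T]_-)$ for all $\lambda\in i\mathbb{R}$ with $|\lambda|\geq\lambda_0'$. *)

(* Defs.v *)
From HB Require Import structures.
From mathcomp Require Export all_boot all_order all_algebra.
From mathcomp Require Export all_classical all_reals all_analysis.
From mathcomp Require Export complex.

Set Implicit Arguments.
Unset Strict Implicit.
Unset Printing Implicit Defensive.
Import Order.TTheory GRing.Theory Num.Theory numFieldNormedType.Exports.
Local Open Scope classical_set_scope.
Local Open Scope complex_scope.
Local Open Scope ring_scope.

(* The multiplication is a field of the structure, and not that of a MathComp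
   ring, because a C*-algebra need not have a unit.  Norms of normed modules
   over R[i] take their values in R[i] (in its nonnegative real part). *)
HB.mixin Record isCStarAlgebra (R : realType) B
    of CompleteNormedModule R[i] B := {
  cmul : B -> B -> B;
  cstar : B -> B;
  cmulA : forall a b c, cmul a (cmul b c) = cmul (cmul a b) c;
  cmulDl : forall a b c, cmul (a + b) c = cmul a c + cmul b c;
  cmulDr : forall a b c, cmul a (b + c) = cmul a b + cmul a c;
  cmulZl : forall (l : R[i]) a b, cmul (l *: a) b = l *: cmul a b;
  cmulZr : forall (l : R[i]) a b, cmul a (l *: b) = l *: cmul a b;
  cstarK : forall a, cstar (cstar a) = a;
  cstarD : forall a b, cstar (a + b) = cstar a + cstar b;
  cstarZ : forall (l : R[i]) a, cstar (l *: a) = l^* *: cstar a;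
  cstarM : forall a b, cstar (cmul a b) = cmul (cstar b) (cstar a);
  cnormM : forall a b, `|cmul a b| <= `|a| * `|b|;
  cnorm_star : forall a, `|cmul (cstar a) a| = `|a| ^+ 2
}.

#[short(type="cstarAlgType")]
HB.structure Definition CStarAlgebra (R : realType) :=
  {B of CompleteNormedModule R[i] B & isCStarAlgebra R B}.

Section CStarOrder.
Context {R : realType} {B : cstarAlgType R}.

Definition cpos (a : B) : Prop := exists b : B, a = cmul (cstar b) b.

Definition cle (a b : B) : Prop := cpos (b - a).

End CStarOrder.

(* Right modules, with an inner product linear in the second variable.  The
   norm is the one of the inner product, so that CompleteNormedModule says
   that E is complete for it. *)
HB.mixin Record isHilbertModule (R : realType) (B : cstarAlgType R) E
    of CompleteNormedModule R[i] E := {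
  ract : E -> B -> E;
  ip : E -> E -> B;
  ractA : forall x a b, ract x (cmul a b) = ract (ract x a) b;
  ractDl : forall x y a, ract (x + y) a = ract x a + ract y a;
  ractDr : forall x a b, ract x (a + b) = ract x a + ract x b;
  ractZl : forall (l : R[i]) x a, ract (l *: x) a = l *: ract x a;
  ractZr : forall (l : R[i]) x a, ract x (l *: a) = l *: ract x a;
  ipDr : forall x y z, ip x (y + z) = ip x y + ip x z;
  ipZr : forall (l : R[i]) x y, ip x (l *: y) = l *: ip x y;
  ip_ract : forall x y a, ip x (ract y a) = cmul (ip x y) a;
  ip_star : forall x y, cstar (ip x y) = ip y x;
  ip_pos : forall x, cpos (ip x x);
  ip_norm : forall x, `|x| ^+ 2 = `|ip x x|
}.

#[short(type="hilbertModType")]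
HB.structure Definition HilbertModule (R : realType) (B : cstarAlgType R) :=
  {E of CompleteNormedModule R[i] E & isHilbertModule R B E}.

Arguments ip {R B s}.
Arguments ract {R B s}.

(* A partial map of E into itself; only the values of ev on Dom matter. *)
Record partialOp (E : Type) := PartialOp { Dom : set E; ev :> E -> E }.

Section PartialMaps.
Context {R : realType} {B : cstarAlgType R} {E : hilbertModType B}.
Implicit Types (A S T : partialOp E) (D : set E) (l : R[i]) (x y z : E).

Definition pop_eq S T : Prop :=
  Dom S = Dom T /\ (forall x, Dom S x -> S x = T x).

Definition pop_graph A : set (E * E) := [set p | Dom A p.1 /\ p.2 = A p.1].

Definition pop_restr A D : partialOp E := PartialOp (Dom A `&` D) A.

Definition pop_comp S T : partialOp E :=
  PartialOp [set x | Dom T x /\ Dom S (T x)] (fun x => S (T x)).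

Definition pop_sub S T : partialOp E :=
  PartialOp (Dom S `&` Dom T) (fun x => S x - T x).

Definition pop_scale l S : partialOp E := PartialOp (Dom S) (fun x => l *: S x).

Definition pop_shift S l : partialOp E := PartialOp (Dom S) (fun x => S x + l *: x).

(* The inverse map when A is injective on its domain. *)
Definition pop_inv A : partialOp E :=
  PartialOp [set A x | x in Dom A]
       (fun y => xget 0 [set x | Dom A x /\ A x = y]).

Definition resolvent S l : partialOp E := pop_inv (pop_shift S l).

Definition commutator S T : partialOp E :=
  pop_sub (pop_comp S T) (pop_comp T S).

Definition submodule D : Prop :=
  [/\ D 0,
      forall x y, D x -> D y -> D (x + y),
      forall l x, D x -> D (l *: x) &
      forall x (b : B), D x -> D (ract x b)].

Definition is_operator T : Prop :=
  [/\ submodule (Dom T),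
      forall x y, Dom T x -> Dom T y -> T (x + y) = T x + T y,
      forall l x, Dom T x -> T (l *: x) = l *: T x &
      forall x (b : B), Dom T x -> T (ract x b) = ract (T x) b].

(* z = T^* y; z is unique when Dom T is dense. *)
Definition adjoint_rel T y z : Prop :=
  forall x, Dom T x -> ip (T x) y = ip x z.

Definition adjoint T : partialOp E :=
  PartialOp [set y | exists z, adjoint_rel T y z]
       (fun y => xget 0 (adjoint_rel T y)).

Definition regular T : Prop :=
  [/\ is_operator T,
      closed (pop_graph T),
      dense (Dom T),
      dense (Dom (adjoint T)) &
      dense [set x + adjoint T (T x) | x in Dom (pop_comp (adjoint T) T)]].

Definition self_adjoint T : Prop := pop_eq T (adjoint T).

Definition is_core D T : Prop :=
  [/\ submodule D, D `<=` Dom T &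
      closure (pop_graph (pop_restr T D)) = pop_graph T].

Definition ip_ST S T x y : B := ip x y + ip (S x) (S y) + ip (T x) (T y).

Definition imaginary l : Prop := complex.Re l = 0.

Definition weakly_commuting S T : Prop :=
  (exists2 C : R, 0 < C &
     forall x, Dom (commutator S T) x ->
       cle (ip (commutator S T x) (commutator S T x))
           (C%:C *: ip_ST S T x x)) /\
  (exists (D : set E) (l0 : R),
     [/\ is_core D T, 0 < l0 &
       forall l, imaginary l -> l0%:C <= `|l| ->
         resolvent S l @` D `<=` Dom (commutator S T)]).

(* Abar is a bounded extension of A; it is unique when Dom A is dense. *)
Definition bounded_extension A (Abar : {linear E -> E}) : Prop :=
  (forall x, Dom A x -> Abar x = A x) /\
  (exists M : R, forall x, `|Abar x| <= M%:C * `|x|).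

(* The operators A l have domain D, have bounded extensions to E which are
   uniformly bounded for l imaginary with `|l| >= l0, and these extensions
   converge strongly to zero as l goes to +i oo and to -i oo. *)
Definition bounded_strongly_null (l0 : R) D (A : R[i] -> partialOp E) : Prop :=
  exists Abar : R[i] -> {linear E -> E},
  [/\ forall l, imaginary l -> l0%:C <= `|l| ->
        Dom (A l) = D /\ bounded_extension (A l) (Abar l),
      exists M : R, forall l, imaginary l -> l0%:C <= `|l| ->
        forall x, `|Abar l x| <= M%:C * `|x|,
      forall x, Abar (0 +i* mu) x @[mu --> +oo] --> (0 : E) &
      forall x, Abar (0 +i* mu) x @[mu --> -oo] --> (0 : E)].

End PartialMaps.

(* Main.v *)
(* Order is used only through [0 <= a <= b -> |a| <= |b|] for a C*-algebra in
   which positive means of the form [b^* b]. It is proved in the unitization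
   without functional calculus: a Hermitian [k] is called positive when
   [|t - k| <= t] for some [t > 0], such elements are norm limits of squares of
   Hermitian elements (by the iteration for the square root), and the norm of a
   Hermitian element is its spectral radius because [|k^(2^j)| = |k|^(2^j)].

   Let [P = (S + l)^-1] and [Q = (T + l)^-1]. On the core, [T P - P T = P Z] with
   [Z = [S, T] P], and weak commutation gives, for large [l],
   [|Z x| <= 2 c (|P x| + |S P x| + |T x| / |l|)]. By closedness [P] maps [Dom T]
   into itself and the same holds on [Dom T]; then
   [l^2 (T P Q - P Q T) = l^2 P Z Q], which is bounded and tends to zero because
   [S P] and [T Q] tend strongly to zero. Moreover [F = P Q - Q P = Q P Z Q], and
   [S P Q - P Q S = - F (S + l)] on [Dom S]. This is [- Q P Z Q (S + l)], which
   tends to zero strongly on [Dom S] after multiplication by [l^2]. Uniform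
   boundedness comes from the adjoint: with [F'] and [Z'] the operators at [- l],
   [f v = <(S + l) x, F' v>] satisfies [f v = <x, Q' Z' Q' v> - f (Z' Q' v)], and
   [Z' Q'] has norm at most [1/2]. *)
From HB Require Import structures.
Require Import Defs.
From mathcomp Require Import ring lra.
Set Implicit Arguments.
Unset Strict Implicit.
Unset Printing Implicit Defensive.
Import Order.TTheory GRing.Theory Num.Theory numFieldNormedType.Exports.
Local Open Scope classical_set_scope.
Local Open Scope complex_scope.
Local Open Scope ring_scope.

(* Norms over [R[i]] take their values in [R[i]]; [nrm] is the real number. *)
Definition nrm (R : realType) (V : normedZmodType R[i]) (x : V) : R :=
  complex.Re `|x|.

(** * Real-valued norms *)

Section RealNorm.
Context {R : realType}.

Section Zmod.
Context {V : normedZmodType R[i]}.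
Implicit Types x y : V.

Lemma normE x : `|x| = (nrm x)%:C.
Proof. by rewrite /nrm RRe_real // ger0_real. Qed.

Lemma nrm_ge0 x : 0 <= nrm x.
Proof. by rewrite -ler0c -normE. Qed.

Lemma nrmD x y : nrm (x + y) <= nrm x + nrm y.
Proof. by rewrite -lecR rmorphD /= -!normE ler_normD. Qed.

Lemma nrmN x : nrm (- x) = nrm x.
Proof. by rewrite /nrm normrN. Qed.

Lemma nrmB x y : nrm (x - y) <= nrm x + nrm y.
Proof. by rewrite -(nrmN y) nrmD. Qed.

Lemma nrmC x y : nrm (x - y) = nrm (y - x).
Proof. by rewrite -nrmN opprB. Qed.

Lemma nrm0 : nrm (0 : V) = 0.
Proof. by rewrite /nrm normr0. Qed.

Lemma nrm_eq0 x : nrm x = 0 -> x = 0.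
Proof. by move=> x0; apply/eqP; rewrite -normr_eq0 normE x0. Qed.

Lemma nrm_le x (c : R) : (`|x| <= c%:C) = (nrm x <= c).
Proof. by rewrite normE lecR. Qed.

End Zmod.

Lemma nrmZ (V : normedModType R[i]) l (x : V) : nrm (l *: x) = nrm l * nrm x.
Proof. by apply: complexI; rewrite rmorphM /= -!normE normrZ. Qed.

Lemma nrmR (t : R) : nrm t%:C = `|t|.
Proof.
by apply: complexI; rewrite -normE normc_def /= expr0n addr0 sqrtr_sqr.
Qed.

Lemma nrm_imag (t : R) : nrm (0 +i* t) = `|t|.
Proof. by apply: complexI; rewrite -normE normc_def /= expr0n add0r sqrtr_sqr. Qed.

End RealNorm.

(** * The unitization of a C*-algebra *)

Definition unitization (R : realType) (B : cstarAlgType R) := (R[i]^o * B)%type.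

Section Unitization.
Context {R : realType} {B : cstarAlgType R}.
Local Notation U := (unitization B).
Implicit Types (a b x y : B) (u v w : U) (l : R[i]) (c t : R).

Lemma cmul0r a : cmul 0 a = 0.
Proof. by apply: (addrI (cmul 0 a)); rewrite -cmulDl !addr0. Qed.

Lemma cmulr0 a : cmul a 0 = 0.
Proof. by apply: (addrI (cmul a 0)); rewrite -cmulDr !addr0. Qed.

Lemma cstar0 : cstar (0 : B) = 0.
Proof. by apply: (addrI (cstar (0 : B))); rewrite -cstarD !addr0. Qed.

(** The product of formal sums [l + a], each written as a pair [(l, a)]. *)
Definition umul u v : U :=
  (u.1 * v.1, (u.1 : R[i]) *: v.2 + (v.1 : R[i]) *: u.2 + cmul u.2 v.2).

HB.instance Definition _ := GRing.Lmodule.copy U (R[i]^o * B)%type.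

Fact umulA : associative umul.
Proof.
move=> [l a] [m b] [n c]; congr (_, _) => /=; first by rewrite mulrA.
rewrite !cmulDr !cmulDl !cmulZl !cmulZr cmulA !scalerDr !scalerA.
rewrite (mulrC m n) (mulrC n l) !addrA.
by rewrite [LHS](ACl (1*2*4*6*3*5*7)%AC).
Qed.

Fact umul1r : left_id ((1, 0) : U) umul.
Proof. by move=> [l a]; rewrite /umul /= mul1r scaler0 scale1r cmul0r !addr0. Qed.

Fact umulr1 : right_id ((1, 0) : U) umul.
Proof.
by move=> [l a]; rewrite /umul /= mulr1 scaler0 scale1r cmulr0 add0r addr0.
Qed.

Fact umulDl : left_distributive umul +%R.
Proof.
move=> [l a] [m b] [n c]; congr (_, _) => /=; first by rewrite mulrDl.
by rewrite cmulDl !scalerDl !scalerDr !addrA [LHS](ACl (1*3*5*2*4*6)%AC).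
Qed.

Fact umulDr : right_distributive umul +%R.
Proof.
move=> [l a] [m b] [n c]; congr (_, _) => /=; first by rewrite mulrDr.
by rewrite cmulDr !scalerDl !scalerDr !addrA [LHS](ACl (1*3*5*2*4*6)%AC).
Qed.

Fact uoner_neq0 : ((1, 0) : U) != 0.
Proof. by apply/eqP => -[/eqP]; rewrite oner_eq0. Qed.

HB.instance Definition _ := GRing.Zmodule_isNzRing.Build U
  umulA umul1r umulr1 umulDl umulDr uoner_neq0.

Fact uscalerAl l u v : l *: (u * v) = (l *: u) * v.
Proof.
case: u v => [m a] [n b]; congr (_, _) => /=; first by rewrite /GRing.scale /= mulrA.
by rewrite !scalerDr !scalerA cmulZl [n * _]mulrC.
Qed.

Fact uscalerAr l u v : l *: (u * v) = u * (l *: v).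
Proof.
case: u v => [m a] [n b]; congr (_, _) => /=; first by rewrite /GRing.scale /= mulrCA.
by rewrite !scalerDr !scalerA cmulZr [l * m]mulrC.
Qed.

HB.instance Definition _ := GRing.Lmodule_isLalgebra.Build R[i] U uscalerAl.
HB.instance Definition _ := GRing.Lalgebra_isAlgebra.Build R[i] U uscalerAr.

Definition ustar u : U := (Num.conj (u.1 : R[i]), cstar u.2).

Lemma ustarK u : ustar (ustar u) = u.
Proof. by case: u => l a; rewrite /ustar /= conjCK cstarK. Qed.

Lemma ustarD u v : ustar (u + v) = ustar u + ustar v.
Proof. by rewrite /ustar /= rmorphD cstarD. Qed.

Lemma ustarZ l u : ustar (l *: u) = Num.conj l *: ustar u.
Proof. by congr (_, _); rewrite /= ?cstarZ // [in LHS]/GRing.scale /= rmorphM. Qed.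

Lemma ustarM u v : ustar (u * v) = ustar v * ustar u.
Proof.
case: u v => [l a] [m b]; congr (_, _) => /=; first by rewrite mulrC rmorphM.
by rewrite !cstarD !cstarZ cstarM [_ *: _ + _ *: _]addrC.
Qed.

Lemma ustar1 : ustar 1 = 1.
Proof. by rewrite /ustar /= rmorph1 cstar0. Qed.

(* The unitization acts on [B] by left multiplication; [unrm] is the operator
   norm, only a seminorm when [B] has a unit. *)
Definition uact u x : B := (u.1 : R[i]) *: x + cmul u.2 x.

Lemma uactM u v x : uact (u * v) x = uact u (uact v x).
Proof.
case: u v => [l a] [m b]; rewrite /uact /= !cmulDl !cmulDr !cmulZl cmulZr cmulA.
by rewrite scalerDr !scalerA -!addrA.
Qed.

Lemma uactD u v x : uact (u + v) x = uact u x + uact v x.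
Proof. by rewrite /uact /= cmulDl scalerDl addrACA. Qed.

Lemma uactZ l u x : uact (l *: u) x = l *: uact u x.
Proof. by rewrite /uact /= cmulZl scalerDr scalerA. Qed.

Lemma uact1 x : uact 1 x = x.
Proof. by rewrite /uact /= scale1r cmul0r addr0. Qed.

Lemma uact_star u x y :
  cmul (cstar (uact u x)) y = cmul (cstar x) (uact (ustar u) y).
Proof.
by rewrite /uact /= cstarD cstarZ cstarM cmulDl cmulDr cmulZl cmulZr cmulA.
Qed.

Lemma cnrmM a b : nrm (cmul a b) <= nrm a * nrm b.
Proof. by rewrite -lecR rmorphM /= -!normE cnormM. Qed.

Lemma cnrm_star a : nrm (cmul (cstar a) a) = nrm a ^+ 2.
Proof. by apply: complexI; rewrite rmorphXn /= -!normE cnorm_star. Qed.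

Lemma nrm_cstar a : nrm (cstar a) = nrm a.
Proof.
suff le b : nrm b <= nrm (cstar b) by apply/le_anti; rewrite le -{2}(cstarK a) le.
have [->|b0] := eqVneq (nrm b) 0; first exact: nrm_ge0.
have b_gt0 : 0 < nrm b by rewrite lt_neqAle eq_sym b0 nrm_ge0.
by rewrite -(ler_pM2r b_gt0) -expr2 -cnrm_star cnrmM.
Qed.

Definition ubounds u : set R :=
  [set c | 0 <= c /\ forall x, nrm (uact u x) <= c * nrm x].

Definition unrm u : R := inf (ubounds u).

Lemma ubounds_has_inf u : has_inf (ubounds u).
Proof.
split; last by exists 0 => c [].
exists (nrm (u.1 : R[i]) + nrm u.2); split; first by rewrite addr_ge0 ?nrm_ge0.
move=> x; rewrite mulrDl; apply: le_trans (nrmD _ _) _.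
by rewrite lerD ?cnrmM // nrmZ.
Qed.

Lemma unrm_le u c : 0 <= c -> (forall x, nrm (uact u x) <= c * nrm x) ->
  unrm u <= c.
Proof. by move=> c0 uc; apply: ge_inf => //; exists 0 => ? []. Qed.

Lemma unrm_ge0 u : 0 <= unrm u.
Proof. by apply: lb_le_inf; [case: (ubounds_has_inf u)|move=> c []]. Qed.

Lemma unrmP u x : nrm (uact u x) <= unrm u * nrm x.
Proof.
have [x0|x0] := eqVneq (nrm x) 0.
  have [[c [c0 cP]] _] := ubounds_has_inf u.
  by move: (cP x); rewrite x0 !mulr0.
have x_gt0 : 0 < nrm x by rewrite lt_neqAle eq_sym x0 nrm_ge0.
rewrite -ler_pdivrMr //; apply: lb_le_inf; first by case: (ubounds_has_inf u).
by move=> c [_ cP]; rewrite ler_pdivrMr.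
Qed.

Lemma unrmD u v : unrm (u + v) <= unrm u + unrm v.
Proof.
apply: unrm_le => [|x]; first by rewrite addr_ge0 ?unrm_ge0.
by rewrite uactD (le_trans (nrmD _ _)) // mulrDl lerD ?unrmP.
Qed.

Lemma unrmM u v : unrm (u * v) <= unrm u * unrm v.
Proof.
apply: unrm_le => [|x]; first by rewrite mulr_ge0 ?unrm_ge0.
rewrite uactM (le_trans (unrmP _ _)) // -mulrA ler_wpM2l ?unrm_ge0 //.
exact: unrmP.
Qed.

Lemma unrmZ_le l u : unrm (l *: u) <= nrm l * unrm u.
Proof.
apply: unrm_le => [|x]; first by rewrite mulr_ge0 ?nrm_ge0 ?unrm_ge0.
by rewrite uactZ nrmZ -mulrA ler_wpM2l ?nrm_ge0 ?unrmP.
Qed.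

Lemma unrm1 : unrm 1 <= 1.
Proof. by apply: unrm_le => // x; rewrite uact1 mul1r. Qed.

(** [|u x|^2 = |x^* (u^* u x)|] by the C*-identity in [B], because [u^*] acts as the adjoint of
    [u]. *)
Lemma unrm_cstar_le u : unrm u ^+ 2 <= unrm (ustar u * u).
Proof.
rewrite -[leRHS]sqr_sqrtr ?unrm_ge0 // ler_sqr ?nnegrE ?sqrtr_ge0 ?unrm_ge0 //.
apply: unrm_le => [|x]; first exact: sqrtr_ge0.
rewrite -ler_sqr ?nnegrE ?mulr_ge0 ?sqrtr_ge0 ?nrm_ge0 // exprMn.
rewrite sqr_sqrtr ?unrm_ge0 // -cnrm_star uact_star -uactM.
rewrite (le_trans (cnrmM _ _)) // nrm_cstar mulrC expr2 mulrA.
by rewrite ler_wpM2r ?nrm_ge0 ?unrmP.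
Qed.

Lemma unrm_star u : unrm (ustar u) = unrm u.
Proof.
suff le v : unrm v <= unrm (ustar v) by apply/le_anti; rewrite le -{2}(ustarK u) le.
have [->|v0] := eqVneq (unrm v) 0; first exact: unrm_ge0.
have v_gt0 : 0 < unrm v by rewrite lt_neqAle eq_sym v0 unrm_ge0.
by rewrite -(ler_pM2r v_gt0) -expr2 (le_trans (unrm_cstar_le _)) ?unrmM.
Qed.

Definition uin a : U := (0, a).

Lemma unrm_in a : unrm (uin a) = nrm a.
Proof.
apply/le_anti/andP; split.
  by apply: unrm_le => [|x]; rewrite ?nrm_ge0 // /uact scale0r add0r cnrmM.
(* Left multiplication by [a^*] is tested on [a] itself, where the C*-identity gives [|a|^2]. *)
have := unrmP (uin (cstar a)) a; rewrite /uact scale0r add0r cnrm_star.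
have -> : uin (cstar a) = ustar (uin a) by rewrite /ustar /= conjC0.
rewrite unrm_star; have [->|a0] := eqVneq (nrm a) 0; first by rewrite unrm_ge0.
by rewrite expr2 ler_pM2r // lt_neqAle eq_sym a0 nrm_ge0.
Qed.

Lemma uinM a b : uin (cmul a b) = uin a * uin b.
Proof. by congr (_, _); rewrite /= ?mul0r // !scale0r !add0r. Qed.

Lemma uin_star a : uin (cstar a) = ustar (uin a).
Proof. by rewrite /ustar /= conjC0. Qed.

End Unitization.

(** * Elementary real inequalities *)

Section RealLemmas.
Context {R : realType}.
Implicit Types (x t D d : R).

Lemma bernoulli d n : 0 <= d -> 1 + n%:R * d <= (1 + d) ^+ n.
Proof.
move=> d0; elim: n => [|n IH]; first by rewrite mul0r addr0 expr0.
have : (1 + d) * (1 + n%:R * d) <= (1 + d) ^+ n.+1.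
  by rewrite exprS ler_wpM2l // addr_ge0.
apply: le_trans; rewrite -natr1.
have : 0 <= n%:R * d ^+ 2 by rewrite mulr_ge0 ?sqr_ge0.
by nra.
Qed.

(** If [x = t (1 + d)] with [d > 0], the square of Bernoulli's inequality makes [(1 + d)^(2 m)] at
    least of order [m^2 d^2] along [m = 2^j], whereas the assumed bound is linear in [m]. *)
Lemma dyadic_root_le x t D : 0 <= x -> 0 < t ->
  (forall j, x ^+ (2 ^ j) <= t ^+ (2 ^ j) * (1 + (2 ^ j)%:R * D)) -> x <= t.
Proof.
move=> x0 t0 xt; rewrite leNgt; apply/negP => ltx.
pose d := x / t - 1.
have d0 : 0 < d by rewrite /d subr_gt0 ltr_pdivlMr ?mul1r.
have dE : x = t * (1 + d) by rewrite /d; field; rewrite gt_eqF.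
have key j : (2 ^ j)%:R * d ^+ 2 <= 2 * D.
  have := xt j.+1; rewrite dE exprMn ler_pM2l ?exprn_gt0 // expnSr exprM natrM.
  have m0 : 0 < (2 ^ j)%:R :> R by rewrite ltr0n expn_gt0.
  have := bernoulli (2 ^ j) (ltW d0).
  set m := (2 ^ j)%:R in m0 *; set y := (1 + d) ^+ _ => yd yD.
  have md0 : 0 < m * d by rewrite mulr_gt0.
  have : (1 + m * d) ^+ 2 <= y ^+ 2.
    by rewrite ler_sqr ?nnegrE // ?(le_trans _ yd) // addr_ge0 // ltW.
  move=> /le_trans /(_ yD) le1.
  rewrite -(ler_pM2l m0).
  by nra.
set q := 2 * D / d ^+ 2.
have := archi_boundP (x := Num.max 0 q).
rewrite le_max lexx => /(_ isT); set K := Num.bound _ => lK.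
have := key K; apply/negP; rewrite -ltNge -ltr_pdivrMr ?exprn_gt0 //.
apply: le_lt_trans (_ : K%:R < _).
  by apply: le_trans (ltW lK); rewrite le_max lexx orbT.
by rewrite ltr_nat ltn_expl.
Qed.

Lemma ler_addgt0 x y : (forall e, 0 < e -> x <= y + e) -> x <= y.
Proof. by move=> H; apply/ler_addgt0Pr. Qed.

Lemma ler_addgt0M (c x y : R) : 0 <= c -> (forall e, 0 < e -> x <= y + c * e) -> x <= y.
Proof.
move=> c0 H; apply: ler_addgt0 => e e0.
(* The division is by [c + 1] because [c] may vanish. *)
have c1 : 0 < c + 1 by rewrite ltr_wpDl.
apply: le_trans (H (e / (c + 1)) _) _; first by rewrite divr_gt0.
by rewrite lerD2l mulrCA ger_pMr // ler_pdivrMr // mul1r lerDl.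
Qed.

(* Majorizes [sqrt_iter] below: the same recursion at [u = 1]. *)
Fixpoint sqrt_bound j : R :=
  if j is i.+1 then (1 + sqrt_bound i ^+ 2) / 2 else 0.

Lemma sqrt_bound01 j : 0 <= sqrt_bound j <= 1.
Proof. by elim: j => [|j IH] /=; [rewrite lexx ler01 | nra]. Qed.

(** The increments decrease, so the last of the first [j + 1] is at most their average, and they sum
    to [sqrt_bound j.+1 <= 1]. *)
Lemma sqrt_bound_step j : 0 <= sqrt_bound j.+1 - sqrt_bound j <= j.+1%:R^-1.
Proof.
have incr i : 0 <= sqrt_bound i.+1 - sqrt_bound i.
  by have := sqrt_bound01 i; rewrite /=; nra.
rewrite incr andTb.
suff : j.+1%:R * (sqrt_bound j.+1 - sqrt_bound j) <= sqrt_bound j.+1.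
  move=> H; rewrite -[leRHS]mul1r ler_pdivlMr // mulrC (le_trans H) //.
  by case/andP: (sqrt_bound01 j.+1).
elim: j => [|j IH]; first by rewrite mul1r subr0.
rewrite -natr1 mulrDl mul1r.
have dec : sqrt_bound j.+2 - sqrt_bound j.+1 <= sqrt_bound j.+1 - sqrt_bound j.
  have := incr j; have := sqrt_bound01 j; have := sqrt_bound01 j.+1.
  have -> : sqrt_bound j.+2 - sqrt_bound j.+1 =
    (sqrt_bound j.+1 - sqrt_bound j) * ((sqrt_bound j.+1 + sqrt_bound j) / 2).
    by rewrite /=; field.
  by nra.
have : j.+1%:R * (sqrt_bound j.+2 - sqrt_bound j.+1) <= sqrt_bound j.+1.
  by apply: le_trans IH; rewrite ler_wpM2l.
lra.
Qed.

End RealLemmas.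

Arguments ler_addgt0M {R} c {x y}.

(** * Approximate square roots in the unitization *)

Section Positivity.
Context {R : realType} {B : cstarAlgType R}.
Local Notation U := (unitization B).
Local Notation N := (@unrm R B).
Implicit Types (h k g u v w c : U) (t s e : R).

Definition uscal t : U := (t%:C)%:A.

Lemma conjRC t : Num.conj (t%:C) = t%:C.
Proof. by rewrite conj_Creal // complex_real. Qed.

Lemma conji : Num.conj ('i%C : R[i]) = - 'i%C.
Proof. by rewrite complexiE conjCi. Qed.

Lemma ustar_uscal t : ustar (uscal t) = uscal t.
Proof. by rewrite /uscal ustarZ ustar1 conjRC. Qed.

Lemma ustarN u : ustar (- u) = - ustar u.
Proof. by rewrite -scaleN1r ustarZ rmorphN rmorph1 scaleN1r. Qed.

Lemma ustarB u v : ustar (u - v) = ustar u - ustar v.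
Proof. by rewrite ustarD ustarN. Qed.

Lemma uscalD t s : uscal (t + s) = uscal t + uscal s.
Proof. by rewrite /uscal rmorphD scalerDl. Qed.

Lemma uscalB t s : uscal (t - s) = uscal t - uscal s.
Proof. by rewrite /uscal rmorphB scalerBl. Qed.

Lemma uscal1 : uscal 1 = 1.
Proof. by rewrite /uscal scale1r. Qed.

Lemma uscal0 : uscal 0 = 0.
Proof. by rewrite /uscal scale0r. Qed.

Lemma uscalZ t s : s%:C *: uscal t = uscal (s * t).
Proof. by rewrite /uscal scalerA rmorphM. Qed.

Lemma comm_uscal u t : GRing.comm u (uscal t).
Proof. by rewrite /GRing.comm /uscal mulr_algl mulr_algr. Qed.

Lemma unrmRZ t u : N (t%:C *: u) <= `|t| * N u.
Proof. by rewrite -nrmR unrmZ_le. Qed.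

Lemma unrm_uscal t : 0 <= t -> N (uscal t) <= t.
Proof.
move=> t0; apply: le_trans (unrmRZ _ _) _; rewrite ger0_norm //.
by rewrite ler_piMr // unrm1.
Qed.

Lemma unrmN u : N (- u) = N u.
Proof.
suff le v : N (- v) <= N v by apply/le_anti; rewrite le -{1}(opprK u) le.
rewrite -scaleN1r; apply: le_trans (unrmZ_le _ _) _.
by rewrite nrmN -[1]/(1%:C) nrmR normr1 mul1r.
Qed.

Lemma unrmB u v : N (u - v) <= N u + N v.
Proof. by rewrite -(unrmN v) unrmD. Qed.

Lemma unrmC u v : N (u - v) = N (v - u).
Proof. by rewrite -unrmN opprB. Qed.

Lemma unrm0 : N 0 = 0.
Proof. by apply/le_anti; rewrite unrm_ge0 -uscal0 unrm_uscal. Qed.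

Lemma unrmX u n : N (u ^+ n) <= N u ^+ n.
Proof.
elim: n => [|n IH]; first by rewrite !expr0 unrm1.
by rewrite !exprS (le_trans (unrmM _ _)) // ler_wpM2l ?unrm_ge0.
Qed.

Lemma ustarX u n : ustar (u ^+ n) = ustar u ^+ n.
Proof.
elim: n => [|n IH]; first by rewrite !expr0 ustar1.
by rewrite exprS exprSr ustarM IH.
Qed.

Definition herm u := ustar u = u.

Lemma hermD u v : herm u -> herm v -> herm (u + v).
Proof. by rewrite /herm ustarD => -> ->. Qed.

Lemma hermB u v : herm u -> herm v -> herm (u - v).
Proof. by rewrite /herm ustarB => -> ->. Qed.

Lemma herm_uscal t : herm (uscal t).
Proof. exact: ustar_uscal. Qed.

Lemma herm0 : herm 0.
Proof. by rewrite -uscal0; apply: herm_uscal. Qed.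

Lemma herm1 : herm 1.
Proof. exact: ustar1. Qed.

Lemma hermZ t u : herm u -> herm (t%:C *: u).
Proof. by rewrite /herm ustarZ conjRC => ->. Qed.

Lemma hermM u v : herm u -> herm v -> GRing.comm u v -> herm (u * v).
Proof. by rewrite /herm ustarM => -> -> ->. Qed.

Lemma hermX u n : herm u -> herm (u ^+ n).
Proof. by rewrite /herm ustarX => ->. Qed.

Lemma herm_cstar u : herm (ustar u * u).
Proof. by rewrite /herm ustarM ustarK. Qed.

Lemma herm_csq u : herm (u * ustar u).
Proof. by rewrite /herm ustarM ustarK. Qed.

(* By the C*-identity the norm of a Hermitian element is its spectral radius. *)
Lemma unrm_herm_pow u j : herm u -> N u ^+ (2 ^ j) <= N (u ^+ (2 ^ j)).
Proof.
move=> hu; elim: j => [|j IH]; first by rewrite !expr1.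
rewrite expnSr !exprM; apply: le_trans (_ : N (u ^+ (2 ^ j)) ^+ 2 <= _).
  by rewrite ler_sqr ?nnegrE ?exprn_ge0 ?unrm_ge0.
by rewrite [X in _ <= N X]expr2 -{2}(hermX (2 ^ j) hu) unrm_cstar_le.
Qed.

(* The limit [y] satisfies [2 y = u + y^2], that is [(1 - y)^2 = 1 - u]. *)
Fixpoint sqrt_iter u j : U :=
  if j is i.+1 then (2^-1 : R)%:C *: (u + sqrt_iter u i * sqrt_iter u i) else 0.

Lemma sqrt_iterS u j :
  sqrt_iter u j.+1 = (2^-1 : R)%:C *: (u + sqrt_iter u j * sqrt_iter u j).
Proof. by []. Qed.

Lemma unrm_half u : N ((2^-1 : R)%:C *: u) <= N u / 2.
Proof. by rewrite mulrC -[X in X * _]ger0_norm ?invr_ge0 // unrmRZ. Qed.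

Lemma half_double u : (2^-1 : R)%:C *: (u + u) = u.
Proof.
rewrite -mulr2n -(@scaler_nat R[i]) scalerA -(rmorph_nat (real_complex R)) -rmorphM.
by rewrite mulVf ?pnatr_eq0 // scale1r.
Qed.

(** The iterates and their increments are dominated by those of [sqrt_bound], and the defect of
    [g = 1 - y_j] is exactly [2 (y_j - y_(j+1))]. Stopping at a finite [j] keeps [g] a polynomial in
    [u], whence the commutation. *)
Lemma sqrt_approx u e : herm u -> N u <= 1 -> 0 < e ->
  exists g, [/\ herm g, forall w, GRing.comm w u -> GRing.comm w g &
                N (1 - u - g * g) <= e].
Proof.
move=> hu u1 e0; pose y := sqrt_iter u; pose b := @sqrt_bound R.
have hy j : herm (y j).
  elim: j => [|j IH]; first exact: herm0.
  by apply/hermZ/hermD => //; apply: hermM.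
have cy w j : GRing.comm w u -> GRing.comm w (y j).
  move=> wu; elim: j => [|j IH]; first exact: commr0.
  rewrite /GRing.comm /y sqrt_iterS -scalerAr -scalerAl; congr (_ *: _).
  by apply: commrD => //; apply: commrM.
have Ny j : N (y j) <= b j.
  elim: j => [|j IH]; first by rewrite unrm0.
  apply: le_trans (unrm_half _) _.
  rewrite ler_wpM2r ?invr_ge0 // (le_trans (unrmD _ _)) // lerD //.
  by rewrite (le_trans (unrmM _ _)) // expr2 ler_pM ?unrm_ge0.
have Nd j : N (y j.+1 - y j) <= b j.+1 - b j.
  elim: j => [|j IH]; first by rewrite !subr0 Ny.
  have -> : y j.+2 - y j.+1 = (2^-1 : R)%:C *:
      (y j.+1 * (y j.+1 - y j) + (y j.+1 - y j) * y j).
    rewrite {1}/y sqrt_iterS -/y {4}/y sqrt_iterS -/y -scalerBr; congr (_ *: _).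
    by rewrite mulrBr mulrBl addrA subrK opprD addrACA subrr add0r.
  have -> : b j.+2 - b j.+1 = (b j.+1 * (b j.+1 - b j) + (b j.+1 - b j) * b j) / 2.
    by rewrite {1 2}/b /= -/b; field.
  apply: le_trans (unrm_half _) _.
  rewrite ler_wpM2r ?invr_ge0 // (le_trans (unrmD _ _)) //.
  by rewrite lerD // (le_trans (unrmM _ _)) // ler_pM ?unrm_ge0.
(* The defect will be at most [2 / (j + 1)]. *)
pose j := Num.bound (2 / e).
have jP : 2 / e < j%:R by apply: archi_boundP; rewrite divr_ge0 // ltW.
exists (1 - y j); split.
- by apply: hermB => //; apply: herm1.
- by move=> w wu; apply: commrB; [apply: commr1 | apply: cy].
have -> : 1 - u - (1 - y j) * (1 - y j) = (y j - y j.+1) + (y j - y j.+1).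
  have -> : (y j - y j.+1) + (y j - y j.+1) = y j + y j - (u + y j * y j).
    by rewrite addrACA -opprD -[u + _]half_double scalerDr -!sqrt_iterS.
  rewrite mulrBl mul1r mulrBr mulr1 !opprB !opprD !addrA.
  by rewrite [LHS](ACl (3*5*2*4*(1*6))%AC) /= subrr addr0.
apply: le_trans (unrmD _ _) _; rewrite unrmC.
have /andP[_ H] := sqrt_bound_step (R := R) j.
apply: le_trans (lerD (Nd j) (Nd j)) _.
apply: le_trans (lerD H H) _.
have j0 : 0 < j.+1%:R :> R by rewrite ltr0n.
rewrite -(ler_pM2r j0) mulrDl mulVf ?gt_eqF // mulrC -ler_pdivrMr //.
by rewrite (le_trans (ltW jP)) // ler_nat.
Qed.

(* [v = h + i g] is normal with [v^* v = h^2 + g^2]. *)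
Lemma unrm_sqr_le h g : herm h -> herm g -> GRing.comm h g ->
  N h ^+ 2 <= N (h * h + g * g).
Proof.
move=> hh hg hgC; pose v := h + 'i%C *: g.
have vs : ustar v = h - 'i%C *: g.
  by rewrite /v ustarD ustarZ hh hg conji scaleNr.
have vv : ustar v * v = h * h + g * g.
  have ii : 'i%C * 'i%C = -1 :> R[i] by rewrite -expr2 sqr_i.
  rewrite vs /v mulrBl !mulrDr -!scalerAr -!scalerAl !scalerA ii scaleN1r hgC.
  by rewrite opprD opprK addrA addrK.
have Nv : N h <= N v.
  have -> : h = (2^-1 : R)%:C *: (v + ustar v).
    by rewrite vs /v addrACA subrr addr0 half_double.
  apply: le_trans (unrm_half _) _; rewrite ler_pdivrMr //.
  rewrite (le_trans (unrmD _ _)) // unrm_star; lra.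
rewrite -vv; apply: le_trans (unrm_cstar_le v).
by rewrite ler_sqr ?nnegrE ?unrm_ge0.
Qed.

(** For [g^2] close to [1 - h^2], the sum [g^2 + h^2] is close to [1], so [unrm_sqr_le] bounds
    [|g|^2] by nearly [1], and [|1 - h^2|] with it. *)
Lemma unrm_one_sub_sqr h : herm h -> N h <= 1 -> N (1 - h * h) <= 1.
Proof.
move=> hh h1; apply: (@ler_addgt0M _ 2) => // e e0.
have hhh : herm (h * h) by apply: hermM.
have [|g [hg gC Ng]] := @sqrt_approx (h * h) e hhh _ e0.
  by rewrite (le_trans (unrmM _ _)) // mulr_ile1 ?unrm_ge0.
have hgC : GRing.comm h g by apply: gC; apply: commrM.
have Ng2 : N g ^+ 2 <= 1 + e.
  rewrite (le_trans (unrm_sqr_le hg hh (commr_sym hgC))) //.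
  have -> : g * g + h * h = 1 - (1 - h * h - g * g).
    by rewrite -[1 - _ - _]addrA -opprD subKr addrC.
  by rewrite (le_trans (unrmB _ _)) // lerD ?unrm1.
have -> : 1 - h * h = g * g + (1 - h * h - g * g) by rewrite [RHS]addrC subrK.
rewrite (le_trans (unrmD _ _)) //.
have : N (g * g) <= 1 + e by rewrite (le_trans _ Ng2) // expr2 unrmM.
lra.
Qed.

End Positivity.

(** * The positive cone *)

Section PositiveCone.
Context {R : realType} {B : cstarAlgType R}.
Local Notation U := (unitization B).
Local Notation N := (@unrm R B).
Local Notation uscal := (@uscal R B).
Implicit Types (h k g u v w c : U) (t s e : R).

Definition pos k := herm k /\ exists2 t, 0 < t & N (uscal t - k) <= t.

Lemma unrm_sub_sqr h t : herm h -> 0 < t -> N h ^+ 2 <= t ->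
  N (uscal t - h * h) <= t.
Proof.
move=> hh t0 ht; pose r := Num.sqrt t.
have r0 : 0 < r by rewrite sqrtr_gt0.
have rr : r * r = t by rewrite -expr2 sqr_sqrtr // ltW.
pose h' := r^-1%:C *: h.
have h'1 : N h' <= 1.
  apply: le_trans (unrmRZ _ _) _; rewrite gtr0_norm ?invr_gt0 //.
  rewrite ler_pdivrMl // mulr1 -ler_sqr ?nnegrE ?unrm_ge0 ?(ltW r0) //.
  by rewrite [leRHS]expr2 rr.
have -> : uscal t - h * h = t%:C *: (1 - h' * h').
  rewrite scalerBr /h' -scalerAl -scalerAr !scalerA -!rmorphM.
  by rewrite -mulrA -invfM rr divff ?gt_eqF // scale1r.
apply: le_trans (unrmRZ _ _) _; rewrite gtr0_norm // ger_pMr //.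
by apply: unrm_one_sub_sqr => //; apply: hermZ.
Qed.

Lemma pos_sqr h : herm h -> pos (h * h).
Proof.
move=> hh; split; first exact: hermM.
exists (N h ^+ 2 + 1); first by rewrite ltr_wpDl ?sqr_ge0.
by apply: unrm_sub_sqr; rewrite // ?ltr_wpDl ?sqr_ge0 // lerDl.
Qed.

Lemma posD k h : pos k -> pos h -> pos (k + h).
Proof.
move=> [hk [t t0 kt]] [hh [s s0 hs]]; split; first exact: hermD.
exists (t + s); first exact: addr_gt0.
by rewrite uscalD opprD addrACA (le_trans (unrmD _ _)) // lerD.
Qed.

Lemma pos_herm k : pos k -> herm k. Proof. by case. Qed.

Lemma posZ t k : 0 <= t -> pos k -> pos (t%:C *: k).
Proof.
rewrite le_eqVlt => /predU1P[<-|t0] [hk [s s0 ks]].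
  by split; [exact: hermZ|exists 1; rewrite // scale0r subr0 unrm_uscal].
split; [exact: hermZ|exists (t * s)]; first by rewrite mulr_gt0.
rewrite -uscalZ -scalerBr (le_trans (unrmRZ _ _)) // gtr0_norm //.
by rewrite ler_pM2l.
Qed.

Lemma pos_sub_small h t : herm h -> 0 < t -> N h <= t -> pos (uscal t - h).
Proof.
move=> he t0 et; split; first by apply: hermB => //; apply: herm_uscal.
by exists t; rewrite // subKr.
Qed.

Lemma pos_uscal t : 0 <= t -> pos (uscal t).
Proof.
move=> t0; rewrite -[t]mulr1 -uscalZ; apply: posZ => //.
by rewrite uscal1 -[1]mulr1; apply/pos_sqr/herm1.
Qed.

(** Writing [k = t (1 - u)] with [|u| <= 1] reduces this to [sqrt_approx], the root being multiplied
    by the square root of [t]. *)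
Lemma pos_sqrt k e : pos k -> 0 < e ->
  exists g, [/\ herm g, forall w, GRing.comm w k -> GRing.comm w g &
                N (k - g * g) <= e].
Proof.
move=> [hk [t t0 kt]] e0.
pose u := t^-1%:C *: (uscal t - k).
have hu : herm u by apply: hermZ; apply: hermB => //; apply: herm_uscal.
have u1 : N u <= 1.
  apply: le_trans (unrmRZ _ _) _; rewrite gtr0_norm ?invr_gt0 //.
  by rewrite ler_pdivrMl // mulr1.
have [g [hg gC Ng]] := sqrt_approx hu u1 (divr_gt0 e0 t0).
pose r := Num.sqrt t; have rr : r * r = t by rewrite -expr2 sqr_sqrtr // ltW.
exists (r%:C *: g); split; first exact: hermZ.
  move=> w wk; rewrite /GRing.comm -scalerAr -scalerAl gC //.
  rewrite /GRing.comm /u -scalerAr -scalerAl; congr (_ *: _).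
  by apply: commrB => //; apply: comm_uscal.
have -> : k - (r%:C *: g) * (r%:C *: g) = t%:C *: (1 - u - g * g).
  rewrite !scalerBr -scalerAl -scalerAr !scalerA -!rmorphM rr divff ?gt_eqF //.
  by rewrite !scale1r subKr.
apply: le_trans (unrmRZ _ _) _; rewrite gtr0_norm //.
by rewrite mulrC -ler_pdivlMr.
Qed.

(** The definition of [pos] supplies a single [t]; here every positive [t >= |k|] is shown to work,
    because [k] is nearly a square [g^2] with [|g|^2] nearly at most [t]. *)
Lemma pos_bound k t : pos k -> 0 < t -> N k <= t -> N (uscal t - k) <= t.
Proof.
move=> pk t0 kt; apply: (ler_addgt0M 3) => // e e0.
have [g [hg _ Ng]] := pos_sqrt pk e0.
have Ng2 : N g ^+ 2 <= t + e.
  rewrite (le_trans (unrm_cstar_le g)) // hg.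
  have -> : g * g = k - (k - g * g) by rewrite subKr.
  by rewrite (le_trans (unrmB _ _)) // lerD.
have -> : uscal t - k = uscal (t + e) - g * g - (uscal e + (k - g * g)).
  rewrite uscalD opprD opprB !addrA.
  by rewrite [RHS](ACl (1*6*(2*4)*(3*5))%AC) /= subrr addNr !addr0.
rewrite (le_trans (unrmB _ _)) //.
have := unrm_sub_sqr hg (addr_gt0 t0 e0) Ng2.
have := unrmD (uscal e) (k - g * g); have := unrm_uscal (B := B) (ltW e0).
lra.
Qed.

(** By [pos_bound] the same [t = |k| + 1] serves all approximants within distance [1] of [k], and
    the inequality passes to the limit. *)
Lemma pos_lim k : herm k ->
  (forall e, 0 < e -> exists2 k', pos k' & N (k - k') <= e) -> pos k.
Proof.
move=> hk H; split=> //; exists (N k + 1); first by rewrite ltr_wpDl ?unrm_ge0.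
apply: ler_addgt0 => e e0; pose d := Num.min 1 e.
have d0 : 0 < d by rewrite lt_min ltr01.
have [k' pk' kk'] := H d d0.
have Nk' : N k' <= N k + 1.
  have -> : k' = k - (k - k') by rewrite subKr.
  by rewrite (le_trans (unrmB _ _)) // lerD // (le_trans kk') // ge_min lexx.
have -> : uscal (N k + 1) - k = (uscal (N k + 1) - k') - (k - k').
  by rewrite opprB addrA subrK.
rewrite (le_trans (unrmB _ _)) // lerD //.
  by apply: pos_bound => //; rewrite ltr_wpDl ?unrm_ge0.
by rewrite (le_trans kk') // ge_min lexx orbT.
Qed.

(** [u] commutes with the approximate root [g] of [k], so [u k u] is a limit of squares of the
    Hermitian elements [u g]. *)
Lemma pos_conj k u : pos k -> herm u -> GRing.comm u k -> pos (u * k * u).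
Proof.
move=> pk hu uk; apply: pos_lim => [|e e0].
  by rewrite /herm !ustarM hu (pos_herm pk) mulrA.
have n0 : 0 < N u ^+ 2 + 1 by rewrite ltr_wpDl ?sqr_ge0.
have [g [hg gC Ng]] := pos_sqrt pk (divr_gt0 e0 n0).
have ug : GRing.comm u g by apply: gC.
exists (u * g * (u * g)); first by apply/pos_sqr/hermM.
have -> : u * k * u - u * g * (u * g) = u * (k - g * g) * u.
  by rewrite mulrBr mulrBl; congr (_ - _); rewrite [u * (g * g)]mulrA -[RHS]mulrA -ug.
rewrite (le_trans (unrmM _ _)) // mulrC.
apply: le_trans (ler_wpM2l (unrm_ge0 _) (unrmM _ _)) _.
rewrite mulrA -expr2 (le_trans (ler_wpM2l (sqr_ge0 _) Ng)) //.
by rewrite mulrA ler_pdivrMr // mulrC ler_pM2l // lerDl.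
Qed.

(** An approximate root [g] of [s - q^2] commutes with [q], so [|q|^2 <= |q^2 + g^2|], which is
    nearly at most [s]. *)
Lemma unrm_sqr_pos q s : herm q -> 0 <= s -> pos (uscal s - q * q) ->
  N q ^+ 2 <= s.
Proof.
move=> hq s0 sq; apply: ler_addgt0 => e e0.
have [g [hg gC Ng]] := pos_sqrt sq e0.
have qg : GRing.comm q g.
  by apply: gC; apply: commrB; [apply: comm_uscal|apply: commrM].
apply: le_trans (unrm_sqr_le hq hg qg) _.
have -> : q * q + g * g = uscal s - (uscal s - q * q - g * g).
  by rewrite -[uscal s - _ - _]addrA -opprD subKr.
by rewrite (le_trans (unrmB _ _)) // lerD // unrm_uscal.
Qed.

(** [k] is replaced by a nearby square [q^2], to which [unrm_sqr_pos] applies with [s + e]; the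
    extra [e] absorbs [q^2 - k]. *)
Lemma unrm_le_pos k s : 0 <= s -> pos k -> pos (uscal s - k) -> N k <= s.
Proof.
move=> s0 pk sk; apply: (ler_addgt0M 2) => // e e0.
have [q [hq _ Nq]] := pos_sqrt pk e0.
have hd : herm (k - q * q) by apply: hermB; [case: pk|apply: hermM].
have : N q ^+ 2 <= s + e.
  apply: unrm_sqr_pos => //; first by rewrite addr_ge0 // ltW.
  have -> : uscal (s + e) - q * q = (uscal s - k) + (uscal e - (q * q - k)).
    by rewrite uscalD opprB !addrA [RHS](ACl (1*3*5*(2*4))%AC) /= addNr addr0.
  apply: posD => //; apply: pos_sub_small => //; last by rewrite unrmC.
  by apply: hermB; [apply: hermM|case: pk].
have -> : k = q * q + (k - q * q) by rewrite [RHS]addrC subrK.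
have := unrmD (q * q) (k - q * q); have := unrmM q q.
rewrite expr2; lra.
Qed.

(* [(r + c c^* )^n = r^n + c (sum_j r^(n-1-j) (r + c^* c)^j) c^*], and norms of
   powers of Hermitian elements are powers of norms. *)
Lemma pos_csq_swap c s : 0 <= s -> pos (uscal s - ustar c * c) ->
  pos (uscal s - c * ustar c).
Proof.
move=> s0 ps; have hcc := herm_csq c.
split; first by apply: hermB => //; apply: herm_uscal.
(* [t >= s] makes [r] nonnegative, [t >= |s - c^* c|] permits [pos_bound], and the [1] makes [t]
   positive. *)
pose t := s + N (uscal s - ustar c * c) + 1.
have t0 : 0 < t by rewrite ltr_wpDl // addr_ge0 ?unrm_ge0.
pose r := t - s; have r0 : 0 <= r by rewrite subr_ge0 /t -addrA lerDl addr_ge0 ?unrm_ge0.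
have rt : r <= t by rewrite /r gerBl.
exists t => //.
have E v : uscal t - (uscal s - v) = uscal r + v by rewrite opprB addrA addrAC -uscalB.
have Nt : N (uscal r + ustar c * c) <= t.
  rewrite -E; apply: pos_bound => //.
  by rewrite /t -addrA [s + _]addrC -addrA lerDl addr_ge0.
(* For [X = r + c c^*], this [D] encodes [|X^n| <= t^n + n |c|^2 t^(n-1)], which is proved below
   multiplied by [t] to avoid the exponent [n - 1]. *)
rewrite E; apply: (dyadic_root_le (D := N c ^+ 2 / t)) => [||j] //; first exact: unrm_ge0.
have hr : herm (uscal r + c * ustar c) by apply: hermD => //; apply: herm_uscal.
apply: le_trans (unrm_herm_pow _ hr) _; set n := (2 ^ j)%N.
have swap i : (uscal r + c * ustar c) ^+ i * c = c * (uscal r + ustar c * c) ^+ i.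
  elim: i => [|i IH]; first by rewrite !expr0 mul1r mulr1.
  rewrite exprS -mulrA IH exprS !mulrA; congr (_ * _).
  by rewrite mulrDl mulrDr !mulrA (commr_sym (comm_uscal c r)).
have Nr : N (uscal r) <= t by rewrite (le_trans (unrm_uscal r0)).
have H i : t * N ((uscal r + c * ustar c) ^+ i) <= t ^+ i.+1 + i%:R * (N c ^+ 2 * t ^+ i).
  elim: i => [|i IH]; first by rewrite mul0r addr0 expr1 expr0 ler_piMr ?unrm1 // ltW.
  have -> : (uscal r + c * ustar c) ^+ i.+1 =
      (uscal r + c * ustar c) ^+ i * uscal r + c * (uscal r + ustar c * c) ^+ i * ustar c.
    by rewrite exprSr mulrDr mulrA swap.
  have N1 : N ((uscal r + c * ustar c) ^+ i * uscal r) <=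
      t * N ((uscal r + c * ustar c) ^+ i).
    by rewrite mulrC (le_trans (unrmM _ _)) // ler_wpM2l ?unrm_ge0.
  have N2 : N (c * (uscal r + ustar c * c) ^+ i * ustar c) <= N c ^+ 2 * t ^+ i.
    apply: le_trans (unrmM _ _) _; rewrite unrm_star mulrC expr2 -mulrA.
    rewrite ler_wpM2l ?unrm_ge0 // (le_trans (unrmM _ _)) // ler_wpM2l ?unrm_ge0 //.
    by rewrite (le_trans (unrmX _ _)) // lerXn2r ?nnegrE ?unrm_ge0 ?(ltW t0).
  apply: le_trans (ler_wpM2l (ltW t0) (le_trans (unrmD _ _) (lerD N1 N2))) _.
  rewrite mulrDr (le_trans (lerD (ler_wpM2l (ltW t0) IH) (lexx _))) //.
  rewrite le_eqVlt; apply/orP; left; apply/eqP.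
  by rewrite -natr1 !exprS; ring.
rewrite -(ler_pM2l t0) (le_trans (H n)) // exprS.
rewrite le_eqVlt; apply/orP; left; apply/eqP; field.
by rewrite gt_eqF.
Qed.

(** Up to sign, [x] and [y] are twice the real and imaginary parts of [c], and the sum is
    [(x^2 + y^2) / 2]. *)
Lemma pos_csq_add c : pos (c * ustar c + ustar c * c).
Proof.
pose x := c + ustar c; pose y := 'i%C *: (c - ustar c).
have hx : herm x by rewrite /herm ustarD ustarK addrC.
have hy : herm y by rewrite /herm ustarZ ustarB ustarK conji scaleNr -scalerN opprB.
have ii : 'i%C * 'i%C = -1 :> R[i] by rewrite -expr2 sqr_i.
have -> : c * ustar c + ustar c * c = (2^-1 : R)%:C *: (x * x + y * y).
  have -> : x * x + y * y = c * ustar c + ustar c * c + (c * ustar c + ustar c * c).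
    rewrite /y -scalerAl -scalerAr scalerA ii scaleN1r /x !mulrDl !mulrDr.
    rewrite !mulNr !mulrN opprK !opprD !opprK !addrA.
    by rewrite [LHS](ACl (2*3*6*7*(1*5)*(4*8))%AC) /= !subrr !addr0.
  by rewrite half_double.
by apply: posZ; [rewrite invr_ge0|apply: posD; apply: pos_sqr].
Qed.

(** Positivity of [c c^*] is not yet available. Instead [1 + c c^*] is positive as the sum of
    [c c^* + c^* c] and [1 - c^* c], and it is at most [2] by [pos_csq_swap]. Hence [|c c^*| <= 3],
    and [|c^* c| <= |c|^2 <= |c c^*|]. *)
Lemma unrm_le_csq c : pos (1 - ustar c * c) -> N (ustar c * c) <= 3.
Proof.
rewrite -uscal1 => p1; have p2 := pos_csq_swap ler01 p1.
have p3 : pos (uscal 1 + c * ustar c).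
  have -> : uscal 1 + c * ustar c = c * ustar c + ustar c * c + (uscal 1 - ustar c * c).
    by rewrite [uscal 1 - _]addrC !addrA addrK addrC.
  by apply: posD => //; apply: pos_csq_add.
have : N (uscal 1 + c * ustar c) <= 2.
  apply: unrm_le_pos => //.
  suff -> : uscal 2 - (uscal 1 + c * ustar c) = uscal 1 - c * ustar c by [].
  by rewrite opprD addrA -uscalB; congr (uscal _ - _); ring.
have : N (c * ustar c) <= N (uscal 1 + c * ustar c) + N (uscal 1).
  have {1}-> : c * ustar c = (uscal 1 + c * ustar c) - uscal 1 by rewrite addrC addKr.
  exact: unrmB.
have := unrm_uscal (B := B) (@ler01 R).
have := unrm_cstar_le (ustar c); rewrite ustarK unrm_star.
have := unrmM (ustar c) c; rewrite unrm_star -expr2.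
lra.
Qed.

(* With [h = c^* c] and [w = 1 - h], [1 - (1 + n h) w^n] is a positive
   combination of the [h^2 w^j]. For [n = 2 m] this bounds [c w^m], hence
   [h w^n], so that [w^n = 1 - sum_(j < n) h w^j] grows at most linearly and the
   norm of [w] is at most [1]. *)
Lemma pos_cstar_small c : N c <= 1 -> pos (ustar c * c).
Proof.
move=> c1; have [h hE] : exists h, h = ustar c * c by eexists.
have [w wE] : exists w, w = 1 - h by eexists.
have hh : herm h by rewrite hE; apply: herm_cstar.
have hw : herm w by rewrite wE; apply: hermB => //; apply: herm1.
have h1 : N h <= 1.
  by rewrite hE (le_trans (unrmM _ _)) // unrm_star mulr_ile1 ?unrm_ge0.
have pw : pos w by rewrite wE -uscal1; apply: pos_sub_small.
have hwC : GRing.comm h w by rewrite wE; apply: commrB; [apply: commr1|].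
have hwX n : GRing.comm h (w ^+ n) by apply: commrX.
(* The induction goes by two, conjugating with [w]; the odd powers start from [w h^2 = h w h]. *)
have pwh n : pos (w ^+ n * (h * h)).
  elim/ltn_ind: n => -[_|[_|n IH]].
  - by rewrite mul1r; apply: pos_sqr.
  - by rewrite expr1 mulrA -hwC; apply: pos_conj.
  - have -> : w ^+ n.+2 * (h * h) = w * (w ^+ n * (h * h)) * w.
      rewrite exprS exprSr -!mulrA; do 2!congr (_ * _).
      by rewrite mulrA -hwC -!mulrA; congr (_ * _); rewrite hwC.
    apply: pos_conj; [exact: IH|exact: hw|].
    by apply: commrM; [exact: commrX|apply: commrM; exact: commr_sym].
pose f n : U := (1 + h *+ n) * w ^+ n.
have fS n : f n = f n.+1 + (w ^+ n * (h * h)) *+ n.+1.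
  have E : (1 + h *+ n.+1) * w = 1 + h *+ n - (h * h) *+ n.+1.
    rewrite wE mulrBr mulr1 mulrDl mul1r mulrnAl opprD addrA; congr (_ - _).
    by rewrite mulrS [h + _]addrC addrA addrK.
  rewrite /f exprS mulrA E [in RHS]mulrBl.
  suff -> : (h * h) *+ n.+1 * w ^+ n = (w ^+ n * (h * h)) *+ n.+1 by rewrite subrK.
  by rewrite mulrnAl -mulrA hwX mulrA hwX -mulrA.
have pos_mulrn k n : pos k -> pos (k *+ n).
  move=> pk; elim: n => [|n IH]; first by rewrite mulr0n -uscal0; apply: pos_uscal.
  by rewrite mulrS; apply: posD.
have pf n : pos (1 - f n).
  elim: n => [|n IH]; first by rewrite /f expr0 mulr0n addr0 mulr1 subrr -uscal0; apply: pos_uscal.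
  have -> : 1 - f n.+1 = 1 - f n + (w ^+ n * (h * h)) *+ n.+1.
    by rewrite (fS n) opprD addrA addrNK.
  by apply: posD => //; apply: pos_mulrn.
have E m : ustar (c * w ^+ m) * (c * w ^+ m) = h * w ^+ m.*2.
  rewrite ustarM (hermX m hw) mulrA -[_ * _ * c]mulrA -hE -hwX -mulrA -exprD.
  by rewrite addnn.
have Neven m : N (h * w ^+ m.*2) <= 3.
  rewrite -E; apply: unrm_le_csq; rewrite E.
  (* The exponent [0] is treated apart because the decomposition below divides by [n]. *)
  case: m => [|m].
    by rewrite expr0 mulr1 -uscal1; apply: pos_sub_small.
  set n := m.+1.*2.
  have n0 : 0 < n%:R :> R by rewrite ltr0n.
  have -> : 1 - h * w ^+ n =
     n%:R^-1%:C *: (1 - f n + w ^+ n) + uscal (1 - n%:R^-1).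
    have -> : 1 - f n + w ^+ n = 1 - (h * w ^+ n) *+ n.
      by rewrite /f mulrDl mul1r opprD addrA addrAC addrNK mulrnAl.
    rewrite scalerBr -(@scaler_nat R[i]) scalerA -(rmorph_nat (real_complex R)) -rmorphM.
    rewrite mulVf ?gt_eqF // scale1r addrAC; congr (_ - _).
    by rewrite -/(uscal _) -uscalD addrC subrK uscal1.
  apply: posD; last first.
    by apply: pos_uscal; rewrite subr_ge0 invf_le1 // ler1n.
  apply: posZ; first by rewrite invr_ge0 ltW.
  apply: posD => //; rewrite /n -addnn exprD.
  by apply: pos_sqr; apply: hermX.
have Nw2 : N w <= 2.
  by rewrite wE (le_trans (unrmB _ _)) // (_ : 2 = 1 + 1) // lerD ?unrm1.
(* An odd exponent costs one more factor [|w| <= 2]. *)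
have Nall n : N (h * w ^+ n) <= 6.
  rewrite -(odd_double_half n) addnC exprD mulrA (le_trans (unrmM _ _)) //.
  have -> : 6 = 3 * 2 :> R by ring.
  apply: ler_pM; rewrite ?unrm_ge0 //.
  by case: (odd n); rewrite ?expr1 // expr0 (le_trans unrm1) // ler1n.
have Nwn n : N (w ^+ n) <= 1 + n%:R * 6.
  elim: n => [|n IH]; first by rewrite expr0 mul0r addr0 unrm1.
  have -> : w ^+ n.+1 = w ^+ n - h * w ^+ n by rewrite exprS {1}wE mulrBl mul1r.
  rewrite -natr1; have := unrmB (w ^+ n) (h * w ^+ n); have := Nall n.
  lra.
(* The witness [1] requires [|1 - h| = |w| <= 1], which linear growth of the powers of [w]
   forces. *)
rewrite -hE; split=> //; exists 1 => //.
rewrite uscal1 -wE; apply: (dyadic_root_le (D := 6)) => // [|j]; first exact: unrm_ge0.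
by rewrite expr1n mul1r (le_trans (unrm_herm_pow _ hw)).
Qed.

Theorem pos_cstar c : pos (ustar c * c).
Proof.
pose t := N c + 1; have t0 : 0 < t by rewrite ltr_wpDl ?unrm_ge0.
pose d := t^-1%:C *: c.
have d1 : N d <= 1.
  apply: le_trans (unrmRZ _ _) _; rewrite gtr0_norm ?invr_gt0 //.
  by rewrite ler_pdivrMl // mulr1 lerDl.
have -> : ustar c * c = (t * t)%:C *: (ustar d * d).
  rewrite /d ustarZ conjRC -scalerAl -scalerAr !scalerA -!rmorphM.
  by rewrite mulfK ?gt_eqF // divff ?gt_eqF // scale1r.
by apply: posZ; [rewrite mulr_ge0 // ltW|apply: pos_cstar_small].
Qed.


(** With [a = x^* x] and [b = x^* x + y^* y], the element [|b| - x^* x] is [(|b| - b) + y^* y] in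
    the unitization, a sum of two positive elements, so [unrm_le_pos] applies. *)
Lemma cle_nrm (a b : B) : cpos a -> cle a b -> nrm a <= nrm b.
Proof.
move=> [x ->] [y yE]; rewrite -(unrm_in (cmul _ x)) uinM uin_star.
apply: unrm_le_pos; [exact: nrm_ge0|exact: pos_cstar|].
have bE : b = cmul (cstar y) y + cmul (cstar x) x by rewrite -yE subrK.
have uinD (u v : B) : uin (u + v) = uin u + uin v by congr (_, _); rewrite addr0.
have hb : herm (uin b).
  by rewrite bE uinD !uinM !uin_star; apply: hermD; apply: herm_cstar.
have -> : uscal (nrm b) - ustar (uin x) * uin x =
    (uscal (nrm b) - uin b) + ustar (uin y) * uin y.
  rewrite [in uin b]bE uinD !uinM !uin_star opprD addrA.
  by rewrite [RHS](ACl (1*3*(2*4))%AC) /= addNr addr0.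
apply: posD; last exact: pos_cstar.
split; first by apply: hermB => //; apply: herm_uscal.
exists (nrm b + 1); first by rewrite ltr_wpDl ?nrm_ge0.
have -> : uscal (nrm b + 1) - (uscal (nrm b) - uin b) = uscal 1 + uin b.
  by rewrite opprB uscalD !addrA [LHS](ACl (2*3*(1*4))%AC) /= subrr addr0.
by rewrite (le_trans (unrmD _ _)) // addrC lerD ?unrm_in // unrm_uscal.
Qed.

End PositiveCone.

(** * Approximation, completeness and imaginary scalars *)

Section Approximation.
Context {R : realType}.

Lemma real_complex_gt0 (e : R) : (0 < e%:C) = (0 < e).
Proof. by rewrite -[0 in LHS]/(0%:C) ltcR. Qed.

Lemma posCE (e : R[i]) : 0 < e -> exists2 r : R, 0 < r & e = r%:C.
Proof.
move=> e0; exists (complex.Re e); last by rewrite RRe_real // gtr0_real.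
by rewrite -real_complex_gt0 RRe_real // gtr0_real.
Qed.

Lemma dense_approx (V : normedModType R[i]) (D : set V) (x : V) (e : R) :
  dense D -> 0 < e -> exists2 u, D u & nrm (u - x) <= e.
Proof.
move=> dD e0; have e0C : 0 < e%:C by rewrite real_complex_gt0.
have [|u [xu Du]] := dD (ball x e%:C) _ (ball_open _ _).
  by exists x; apply: ballxx.
exists u => //; move: xu; rewrite -ball_normE /= => /ltW.
by rewrite nrm_le nrmC.
Qed.

Lemma closed_graph_approx (V : normedModType R[i]) (G : set (V * V)) (x y : V) :
  closed G ->
  (forall e, 0 < e -> exists p, [/\ G p, nrm (p.1 - x) <= e & nrm (p.2 - y) <= e]) ->
  G (x, y).
Proof.
move=> cG H; apply: cG => A /nbhs_ballP[e /posCE[r r0 ->]] rA.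
have r2 : 0 < r / 2 by rewrite divr_gt0.
have [p [Gp p1 p2]] := H _ r2; exists p; split=> //; apply: rA.
by split=> /=; rewrite -ball_normE /= normE ltcR nrmC;
  apply: le_lt_trans (_ : r / 2 < r) => //; lra.
Qed.

(* The relation [P e z] reads: z is within e of the limit to be found. *)
Lemma complete_approx (V : completeNormedModType R[i]) (P : R -> V -> Prop) :
  (forall e, 0 < e -> exists z, P e z) ->
  (forall e d z w, P e z -> P d w -> nrm (z - w) <= e + d) ->
  exists l, forall e z, P e z -> nrm (z - l) <= e.
Proof.
move=> exP PP.
have h0 n : 0 < n.+1%:R^-1 :> R by rewrite invr_gt0 ltr0n.
have /choice[f fP] n : exists z, P n.+1%:R^-1 z by apply: exP.
have cf : cvg (f @ \oo).
  apply: cauchy_cvg; apply/cauchyP => e /posCE[r r0 ->].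
  pose n := Num.bound (2 / r).
  have nP : 2 / r < n%:R by apply: archi_boundP; rewrite divr_ge0 // ltW.
  exists (f n); suff : \forall m \near \oo, nrm (f n - f m) < r.
    by apply: filterS => m; rewrite -ball_normE /= normE ltcR.
  near=> m.
  apply: le_lt_trans (PP _ _ _ _ (fP n) (fP m)) _.
  have H k : (n <= k)%N -> k.+1%:R^-1 < r / 2.
    move=> nk; rewrite -[r / 2]invrK ltf_pV2 ?posrE ?ltr0n ?invr_gt0 ?divr_gt0 //.
    by rewrite invf_div (lt_trans nP) // ltr_nat.
  rewrite [r]splitr ltrD ?H //.
  by near: m; exists n.
exists (lim (f @ \oo)) => e z Pz.
apply: ler_addgt0 => d d0.
have d2 : 0 < d / 2 by rewrite divr_gt0.
near \oo => n.
have zn : nrm (z - f n) <= e + n.+1%:R^-1 by apply: PP.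
have nl : nrm (f n - lim (f @ \oo)) <= d / 2.
  rewrite -nrm_le; near: n; apply: cvgr_distC_le => //.
  by rewrite real_complex_gt0 divr_gt0.
have n2 : n.+1%:R^-1 <= d / 2.
  by apply/ltW; near: n; exact: (near_infty_natSinv_lt (PosNum d2)).
have -> : z - lim (f @ \oo) = (z - f n) + (f n - lim (f @ \oo)).
  by rewrite addrA subrK.
rewrite (le_trans (nrmD _ _)) // (le_trans (lerD zn nl)) //.
by move: n2; set v := _^-1; lra.
Unshelve. all: by end_near. Qed.

Definition imag (t : R) : R[i] := 0 +i* t.

Lemma imagN t : imag (- t) = - imag t.
Proof. by rewrite /imag; simpc. Qed.

Lemma imagB t s : imag (t - s) = imag t - imag s.
Proof. by rewrite /imag; simpc. Qed.

Lemma conj_imag t : Num.conj (imag t) = - imag t.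
Proof.
have -> : imag t = 'i%C * t%:C by rewrite /imag; simpc.
by rewrite rmorphM /= conjRC conji mulNr.
Qed.

Lemma imagM t s : imag t * imag s = (- (t * s))%:C.
Proof. by rewrite /imag; simpc. Qed.

Lemma imag_sqr t : imag t ^+ 2 = (- t ^+ 2)%:C.
Proof. by rewrite !expr2 imagM. Qed.

End Approximation.

(** * Inner products and a Cauchy-Schwarz inequality up to a constant *)

Section InnerProduct.
Context {R : realType} {B : cstarAlgType R} {E : hilbertModType B}.
Implicit Types (x y z : E) (l : R[i]).

Lemma ipDl x y z : ip (x + y) z = ip x z + ip y z.
Proof. by rewrite -ip_star ipDr cstarD !ip_star. Qed.

Lemma ipZl l x y : ip (l *: x) y = Num.conj l *: ip x y.
Proof. by rewrite -ip_star ipZr cstarZ ip_star. Qed.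

Lemma ipNr x y : ip x (- y) = - ip x y.
Proof. by rewrite -scaleN1r ipZr scaleN1r. Qed.

Lemma ipNl x y : ip (- x) y = - ip x y.
Proof. by rewrite -scaleN1r ipZl rmorphN rmorph1 scaleN1r. Qed.

Lemma ipBr x y z : ip x (y - z) = ip x y - ip x z.
Proof. by rewrite ipDr ipNr. Qed.

Lemma ipBl x y z : ip (x - y) z = ip x z - ip y z.
Proof. by rewrite ipDl ipNl. Qed.

Lemma ip_nrm x : nrm (ip x x) = nrm x ^+ 2.
Proof. by apply: complexI; rewrite rmorphXn /= -!normE ip_norm. Qed.

Lemma ip_polar_le x y : nrm (ip x y + ip y x) <= (nrm x + nrm y) ^+ 2.
Proof.
have E2 : 2%:C *: (ip x y + ip y x) = ip (x + y) (x + y) - ip (x - y) (x - y).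
  rewrite !ipDl !ipDr !ipNl !ipNr !opprD !opprK !addrA.
  rewrite [RHS](ACl (1*5*(4*8)*((2*3)*(6*7)))%AC) /= !subrr !add0r.
  by rewrite [2%:C]rmorphD scalerDl !rmorph1 !scale1r.
have : nrm (2%:C *: (ip x y + ip y x)) <= 2 * (nrm x + nrm y) ^+ 2.
  rewrite E2 (le_trans (nrmB _ _)) // !ip_nrm mulrDl mul1r.
  rewrite lerD // ler_sqr ?nnegrE ?addr_ge0 ?nrm_ge0 ?nrmD //.
  exact: nrmB.
by rewrite nrmZ nrmR ger0_norm // ler_pM2l.
Qed.

(** [ip u v] is recovered from the symmetrized products of [u] with [v] and with [i v], which
    polarization bounds. Normalizing both vectors turns [(|u| + |v|)^2] into the constant [4]. *)
Lemma ip_nrm_le x y : nrm (ip x y) <= 4 * (nrm x * nrm y).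
Proof.
have le1 (u v : E) : nrm (ip u v) <= (nrm u + nrm v) ^+ 2.
  have E2 : 2%:C *: ip u v =
     (ip u v + ip v u) - 'i%C *: (ip u ('i%C *: v) + ip ('i%C *: v) u).
    rewrite ipZr ipZl conji scaleNr -scalerBr scalerA -expr2 sqr_i scaleN1r opprK.
    rewrite addrACA addrN addr0.
    by rewrite [2%:C]rmorphD scalerDl !rmorph1 !scale1r.
  have : nrm (2%:C *: ip u v) <= 2 * (nrm u + nrm v) ^+ 2.
    rewrite E2 (le_trans (nrmB _ _)) // mulrDl mul1r lerD ?ip_polar_le //.
    have i1 : nrm ('i%C : R[i]) = 1 by rewrite nrm_imag normr1.
    by rewrite nrmZ i1 mul1r (le_trans (ip_polar_le _ _)) // nrmZ i1 mul1r.
  by rewrite nrmZ nrmR ger0_norm // ler_pM2l.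
have [x0|x0] := eqVneq (nrm x) 0.
  have -> : ip x y = 0 by rewrite (nrm_eq0 x0) -(scale0r (0 : E)) ipZl conjC0 scale0r.
  by rewrite nrm0 !mulr_ge0 ?nrm_ge0.
have [y0|y0] := eqVneq (nrm y) 0.
  have -> : ip x y = 0 by rewrite (nrm_eq0 y0) -(scale0r (0 : E)) ipZr scale0r.
  by rewrite nrm0 !mulr_ge0 ?nrm_ge0.
have xp : 0 < nrm x by rewrite lt_neqAle eq_sym x0 nrm_ge0.
have yp : 0 < nrm y by rewrite lt_neqAle eq_sym y0 nrm_ge0.
have := le1 ((nrm x)^-1%:C *: x) ((nrm y)^-1%:C *: y).
rewrite ipZl ipZr conjRC !nrmZ !nrmR !gtr0_norm ?invr_gt0 // !mulVf //.
rewrite mulrA -invfM ler_pdivrMl ?mulr_gt0 // mulrC => /le_trans; apply.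
by rewrite ler_wpM2r ?mulr_ge0 ?nrm_ge0 //; lra.
Qed.

End InnerProduct.

(** * Resolvents of regular self-adjoint operators *)

Section Resolvent.
Context {R : realType} {B : cstarAlgType R} {E : hilbertModType B}.
Variable S : partialOp E.
Hypotheses (regS : regular S) (saS : self_adjoint S).
Implicit Types (x y z : E) (l : R[i]) (m e : R).

Lemma domD x y : Dom S x -> Dom S y -> Dom S (x + y).
Proof. by case: regS => -[[? + _ _] _ _ _] _ _ _ _; apply. Qed.

Lemma domZ l x : Dom S x -> Dom S (l *: x).
Proof. by case: regS => -[[? _ + _] _ _ _] _ _ _ _; apply. Qed.

Lemma domN x : Dom S x -> Dom S (- x).
Proof. by move=> ?; rewrite -scaleN1r; apply: domZ. Qed.

Lemma domB x y : Dom S x -> Dom S y -> Dom S (x - y).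
Proof. by move=> ? ?; apply: domD => //; apply: domN. Qed.

Lemma dom0 : Dom S 0.
Proof. by case: regS => -[[]]. Qed.

Lemma opD x y : Dom S x -> Dom S y -> S (x + y) = S x + S y.
Proof. by case: regS => -[_ + _ _] _ _ _ _; apply. Qed.

Lemma opZ l x : Dom S x -> S (l *: x) = l *: S x.
Proof. by case: regS => -[_ _ + _] _ _ _ _; apply. Qed.

Lemma opN x : Dom S x -> S (- x) = - S x.
Proof. by move=> ?; rewrite -scaleN1r opZ // scaleN1r. Qed.

Lemma opB x y : Dom S x -> Dom S y -> S (x - y) = S x - S y.
Proof. by move=> ? ?; rewrite opD ?opN //; apply: domN. Qed.

Lemma op_sym x y : Dom S x -> Dom S y -> ip (S x) y = ip x (S y).
Proof.
move=> Sx Sy; have [DS SE] := saS.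
have : Dom (adjoint S) y by rewrite -DS.
by move=> [z zP]; rewrite (SE y) //; apply: (@xgetPex _ 0 (adjoint_rel S y)); [exists z|].
Qed.

Lemma closed_op y z :
  (forall e, 0 < e -> exists x, [/\ Dom S x, nrm (x - y) <= e & nrm (S x - z) <= e]) ->
  Dom S y /\ S y = z.
Proof.
move=> H; have [_ cS _ _ _] := regS.
suff [/= Sy zE] : pop_graph S (y, z) by split.
apply: closed_graph_approx => // e /H[x [Sx xy xz]].
by exists (x, S x).
Qed.

(** The cross terms cancel because [S] is symmetric and [imag m] is conjugate to its opposite. *)
Lemma ip_shift x m : Dom S x ->
  ip (S x + imag m *: x) (S x + imag m *: x) =
  ip (S x) (S x) + (m ^+ 2)%:C *: ip x x.
Proof.
move=> Sx; rewrite !ipDl !ipDr !ipZr !ipZl conj_imag (op_sym Sx Sx) scalerA.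
by rewrite mulrN imagM -rmorphN opprK expr2 !addrA scaleNr addrK.
Qed.

Lemma nrm_shift x m : Dom S x -> `|m| * nrm x <= nrm (S x + imag m *: x).
Proof.
move=> Sx; rewrite -nrmR -nrmZ -ler_sqr ?nnegrE ?nrm_ge0 // -!ip_nrm.
apply: cle_nrm; first exact: ip_pos.
by rewrite /cle ip_shift // ipZl ipZr conjRC scalerA -rmorphM -expr2 addrK; apply: ip_pos.
Qed.

Lemma nrm_op_le_shift x m : Dom S x -> nrm (S x) <= nrm (S x + imag m *: x).
Proof.
move=> Sx; rewrite -ler_sqr ?nnegrE ?nrm_ge0 // -!ip_nrm.
apply: cle_nrm; first exact: ip_pos.
rewrite /cle ip_shift // addrC addKr -[_ *: _](_ : ip (m%:C *: x) (m%:C *: x) = _).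
  exact: ip_pos.
by rewrite ipZl ipZr conjRC scalerA -rmorphM -expr2.
Qed.

Definition shift_surj m := forall y, exists2 x, Dom S x & S x + imag m *: x = y.

(** By [nrm_shift] approximate preimages form a Cauchy family, and the closed graph puts their limit
    in the domain. *)
Lemma closed_range m y : m != 0 ->
  (forall e, 0 < e -> exists2 x, Dom S x & nrm (S x + imag m *: x - y) <= e) ->
  exists2 x, Dom S x & S x + imag m *: x = y.
Proof.
move=> m0 H; have mp : 0 < `|m| by rewrite normr_gt0.
have shB x w : Dom S x -> Dom S w ->
    S (x - w) + imag m *: (x - w) = (S x + imag m *: x) - (S w + imag m *: w).
  by move=> Sx Sw; rewrite opB // scalerBr opprD addrACA.
have [||l lP] := @complete_approx R E (fun e x => Dom S x /\
    nrm (S x + imag m *: x - y) <= `|m| * e).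
- by move=> e e0; have [|x Sx xe] := H (`|m| * e); [rewrite mulr_gt0|exists x].
- move=> e d z w [Sz ze] [Sw we].
  rewrite -(ler_pM2l mp) (le_trans (nrm_shift _ (domB Sz Sw))) // shB //.
  have -> : S z + imag m *: z - (S w + imag m *: w) =
     (S z + imag m *: z - y) - (S w + imag m *: w - y).
    by rewrite opprB addrA subrK.
  by rewrite (le_trans (nrmB _ _)) // mulrDr lerD.
have [Sl SlE] : Dom S l /\ S l = y - imag m *: l.
  (* Two errors, each at most [|m| d], have to fit into [e]. *)
  apply: closed_op => e e0; pose d := e / (2 * `|m| + 1).
  have k0 : 0 < 2 * `|m| + 1 by rewrite ltr_wpDl // mulr_ge0.
  have d0 : 0 < Num.min d e by rewrite lt_min e0 divr_gt0.
  have [|x Sx xd] := H (`|m| * Num.min d e); first by rewrite mulr_gt0.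
  have xl := lP _ _ (conj Sx xd).
  have de : Num.min d e <= d by rewrite ge_min lexx.
  exists x; split=> //; first by rewrite (le_trans xl) // ge_min lexx orbT.
  have -> : S x - (y - imag m *: l) = (S x + imag m *: x - y) - imag m *: (x - l).
    rewrite scalerBr !opprB !addrA [RHS](ACl (1*4*3*(2*5))%AC) /= subrr addr0.
    by rewrite -!addrA; congr (_ + _); rewrite addrC.
  rewrite (le_trans (nrmB _ _)) // nrmZ nrm_imag.
  rewrite (le_trans (lerD xd (ler_wpM2l (ltW mp) xl))) // -mulrDr.
  have : `|m| * (Num.min d e + Num.min d e) <= (2 * `|m| + 1) * d.
    have d1 : 0 <= d by rewrite divr_ge0 // ltW.
    by nra.
  by move/le_trans; apply; rewrite /d mulrC divfK ?gt_eqF.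
by exists l; rewrite // SlE subrK.
Qed.

(** [(S + i m) (S - i m) = S^2 + 1] when [m^2 = 1], and regularity together with self-adjointness
    makes the range of [S^2 + 1] dense. *)
Lemma surj_unit m : m ^+ 2 = 1 -> shift_surj m.
Proof.
move=> m1 y; have m0 : m != 0 by apply/eqP => m0; move: m1; rewrite m0 expr0n /=; lra.
apply: closed_range => // e e0.
have [_ _ _ _ dS] := regS; have [DS SE] := saS.
have [_ [x [Sx aSx] <-] ye] := dense_approx y dS e0.
have SSx : Dom S (S x) by rewrite DS.
exists (S x - imag m *: x); first by apply: domB => //; apply: domZ.
suff -> : S (S x - imag m *: x) + imag m *: (S x - imag m *: x) =
  x + adjoint S (S x) by [].
rewrite opB ?opZ //; last exact: domZ.
by rewrite scalerBr addrA subrK scalerA imagM -expr2 m1 rmorphN rmorph1 scaleN1r opprK addrC -SE.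
Qed.

(** A Neumann iteration: correcting by the solution [u] of the equation for [m] leaves the residual
    [i (m - m') u], smaller by the factor [q = |m' - m| / |m|]. Then [closed_range] applies. *)
Lemma surj_step m m' : shift_surj m -> `|m' - m| < `|m| -> m' != 0 ->
  shift_surj m'.
Proof.
move=> sm mm m'0 y; have mp : 0 < `|m| by apply: le_lt_trans mm.
pose q := `|m' - m| / `|m|.
have q0 : 0 <= q by rewrite divr_ge0.
have q1 : q < 1 by rewrite ltr_pdivrMr // mul1r.
have H n : exists2 x, Dom S x & nrm (y - (S x + imag m' *: x)) <= q ^+ n * nrm y.
  elim: n => [|n [x Sx xq]].
    exists 0; first exact: dom0.
    have -> : S 0 = 0 by rewrite -(scale0r (0 : E)) opZ ?scale0r //; apply: dom0.
    by rewrite scaler0 addr0 subr0 mul1r.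
  have [u Su uE] := sm (y - (S x + imag m' *: x)).
  exists (x + u); first exact: domD.
  have -> : y - (S (x + u) + imag m' *: (x + u)) = imag (m - m') *: u.
    rewrite opD // scalerDr addrACA opprD addrA -uE imagB scalerBl.
    by rewrite opprD addrACA subrr add0r.
  rewrite nrmZ nrm_imag distrC exprS -mulrA.
  apply: le_trans (_ : q * nrm (S u + imag m *: u) <= _).
    rewrite /q -mulrA ler_wpM2l // ler_pdivlMl //.
    by rewrite mulrC; rewrite mulrC; apply: nrm_shift.
  by rewrite uE ler_wpM2l.
apply: closed_range => // e e0.
have [n qn] : exists n, q ^+ n * nrm y <= e.
  have : (fun n => q ^+ n) @ \oo --> 0 by apply: cvg_expr; rewrite ger0_norm.
  have ye : 0 < e / (nrm y + 1) by rewrite divr_gt0 // ltr_wpDl ?nrm_ge0.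
  move=> /cvgrPdist_le/(_ _ ye)[n _ /(_ n (leqnn n))] /=.
  rewrite sub0r normrN ger0_norm ?exprn_ge0 // => qn; exists n.
  rewrite (le_trans (ler_wpM2r (nrm_ge0 _) qn)) //.
  rewrite mulrAC ler_pdivrMr ?ltr_wpDl ?nrm_ge0 // ler_pM2l // lerDl //.
have [x Sx xq] := H n; exists x => //.
by rewrite nrmC (le_trans xq).
Qed.

(** Continuation from the sign of [m]: a factor [3 / 2] changes the parameter by half its size,
    within reach of [surj_step], and from [p] the last step reaches every [t] with [0 < t < 2 p]. *)
Lemma shift_surjP m : m != 0 -> shift_surj m.
Proof.
move=> m0; pose s := Num.sg m; pose t := `|m|.
have ts : m = s * t by rewrite /s /t -numEsg.
have t0 : 0 < t by rewrite normr_gt0.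
have s1 : s ^+ 2 = 1 by rewrite sqr_sg m0.
have ns : `|s| = 1 by rewrite normr_sg m0.
have H n : shift_surj (s * (3 / 2) ^+ n).
  elim: n => [|n IH]; first by rewrite mulr1; apply: surj_unit.
  have p0 : 0 < (3 / 2 : R) ^+ n by rewrite exprn_gt0 // divr_gt0.
  apply: (surj_step IH); last first.
    by rewrite mulf_neq0 ?sgr_eq0 // expf_neq0 // gt_eqF // divr_gt0.
  rewrite -mulrBr !normrM ns !mul1r exprS.
  have -> : 3 / 2 * (3 / 2) ^+ n - (3 / 2) ^+ n = (3 / 2 : R) ^+ n / 2 by field.
  rewrite !gtr0_norm ?divr_gt0 //; lra.
have [n tn] : exists n, t < 2 * (3 / 2) ^+ n.
  have := archi_boundP (x := t) (ltW t0); set n := Num.bound _ => tn.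
  exists n; have := @bernoulli R (2^-1) n; rewrite invr_ge0 ler0n => /(_ isT).
  have -> : 1 + 2^-1 = 3 / 2 :> R by field.
  lra.
apply: (surj_step (H n)) => //.
rewrite ts -mulrBr !normrM ns !mul1r.
have p0 : 0 < (3 / 2 : R) ^+ n by rewrite exprn_gt0 // divr_gt0.
rewrite (gtr0_norm p0) ltr_norml; apply/andP; split; lra.
Qed.

Definition res m y : E := resolvent S (imag m) y.

Section NonZero.
Variable m : R.
Hypothesis m0 : m != 0.

Let mp : 0 < `|m|. Proof. by rewrite normr_gt0. Qed.

Lemma shift_inj x y : Dom S x -> Dom S y ->
  S x + imag m *: x = S y + imag m *: y -> x = y.
Proof.
move=> Sx Sy xy; apply/eqP; rewrite -subr_eq0; apply/eqP/nrm_eq0/le_anti.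
rewrite nrm_ge0 andbT -(ler_pM2l mp) mulr0.
apply: le_trans (nrm_shift m (domB Sx Sy)) _.
by rewrite opB // scalerBr addrACA xy -opprD subrr nrm0.
Qed.

Lemma resP y : Dom S (res m y) /\ S (res m y) + imag m *: res m y = y.
Proof.
have [x Sx xy] := shift_surjP m0 y.
by apply: (@xgetPex _ 0 [set x | Dom S x /\ S x + imag m *: x = y]); exists x.
Qed.

Lemma res_dom y : Dom S (res m y). Proof. by case: (resP y). Qed.

Lemma res_eq y : S (res m y) + imag m *: res m y = y.
Proof. by case: (resP y). Qed.

Lemma op_res y : S (res m y) = y - imag m *: res m y.
Proof. by rewrite -{2}(res_eq y) addrK. Qed.

Lemma res_uniq x y : Dom S x -> S x + imag m *: x = y -> res m y = x.
Proof. by move=> Sx <-; apply: shift_inj => //; [exact: res_dom|rewrite res_eq]. Qed.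

Lemma resD x y : res m (x + y) = res m x + res m y.
Proof.
have Dx := res_dom x; have Dy := res_dom y.
apply: res_uniq; first exact: domD.
by rewrite (opD Dx Dy) scalerDr addrACA (res_eq x) (res_eq y).
Qed.

Lemma resZ l x : res m (l *: x) = l *: res m x.
Proof.
have Dx := res_dom x; apply: res_uniq; first exact: domZ.
by rewrite (opZ _ Dx) scalerA [imag m * l]mulrC -scalerA -scalerDr (res_eq x).
Qed.

Lemma resN x : res m (- x) = - res m x.
Proof. by rewrite -scaleN1r resZ scaleN1r. Qed.

Lemma resB x y : res m (x - y) = res m x - res m y.
Proof. by rewrite resD resN. Qed.

Lemma nrm_res y : `|m| * nrm (res m y) <= nrm y.
Proof. by rewrite -{2}(res_eq y); apply: nrm_shift; exact: res_dom. Qed.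

Lemma nrm_op_res y : nrm (S (res m y)) <= nrm y.
Proof. by rewrite -{2}(res_eq y); apply: nrm_op_le_shift; exact: res_dom. Qed.

Lemma res_op x : Dom S x -> res m (S x) = S (res m x).
Proof.
move=> Sx; have Dx := res_dom x; have Zx := domZ (imag m) Dx.
have DSx : Dom S (S (res m x)) by rewrite (op_res x); apply: domB.
by apply: res_uniq => //; rewrite -(opZ _ Dx) -(opD DSx Zx) (res_eq x).
Qed.

Lemma res_dom_resolvent : Dom (resolvent S (imag m)) = setT.
Proof.
by apply/seteqP; split=> // y _; exists (res m y); [exact: res_dom|exact: res_eq].
Qed.

End NonZero.

Lemma res_adj m x y : m != 0 -> ip (res m x) y = ip x (res (- m) y).
Proof.
move=> m0; have m0' : - m != 0 by rewrite oppr_eq0.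
have Dx := res_dom m0 x; have Dy := res_dom m0' y.
rewrite -{1}(res_eq m0' y) -{2}(res_eq m0 x) ipDr ipDl ipZr ipZl conj_imag imagN.
by rewrite (op_sym Dx Dy).
Qed.

(** For [u] in the dense domain, [S (S + i m)^-1 u = (S + i m)^-1 S u] is of order [1 / |m|]; the
    uniform bound [nrm_op_res] extends the convergence to every [x]. *)
Lemma op_res_cvg0 x e : 0 < e ->
  exists2 M : R, 0 < M & forall m, M <= `|m| -> nrm (S (res m x)) <= e.
Proof.
move=> e0; have [_ _ dS _ _] := regS.
have e2 : 0 < e / 2 by rewrite divr_gt0.
have [u Su ux] := dense_approx x dS e2.
exists (2 * (nrm (S u) + 1) / e) => [|m mM].
  by rewrite divr_gt0 // mulr_gt0 // ltr_wpDl ?nrm_ge0.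
have mp : 0 < `|m|.
  by apply: lt_le_trans mM; rewrite divr_gt0 // mulr_gt0 // ltr_wpDl ?nrm_ge0.
have m0 : m != 0 by rewrite -normr_gt0.
have -> : x = u - (u - x) by rewrite subKr.
rewrite (resB m0) (opB (res_dom m0 u) (res_dom m0 (u - x))).
rewrite (le_trans (nrmB _ _)) // [e]splitr lerD //; last first.
  by rewrite (le_trans (nrm_op_res m0 _)).
rewrite -(res_op m0 Su) -(ler_pM2l mp) (le_trans (nrm_res m0 _)) //.
have : 2 * (nrm (S u) + 1) <= `|m| * e by rewrite -ler_pdivrMr.
by have := nrm_ge0 (S u); lra.
Qed.

End Resolvent.

(** * Bounded extensions and strong convergence *)

Lemma linear_exists (K : pzRingType) (V W : lmodType K) (f : V -> W) :
  linear f -> exists L : {linear V -> W}, forall x, L x = f x.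
Proof.
move=> fl; pose m := GRing.isLinear.Build K V W *:%R f fl.
by pose L : {linear V -> W} := HB.pack f m; exists L.
Qed.

Section StrongNullity.
Context {R : realType} {B : cstarAlgType R} {E : hilbertModType B}.
Variable S : partialOp E.
Hypothesis regS : regular S.
Implicit Types (x y z : E) (l : R[i]) (m e : R).

(** The value at [x] is the limit of [V u] as [u] tends to [x] in the domain. The positive constant
    [M + 1] allows division during the construction; [M] itself is recovered at the end by a
    limit. *)
Lemma extend_bounded (V : E -> E) (M : R) : 0 <= M ->
  (forall x y, Dom S x -> Dom S y -> V (x + y) = V x + V y) ->
  (forall l x, Dom S x -> V (l *: x) = l *: V x) ->
  (forall x, Dom S x -> nrm (V x) <= M * nrm x) ->
  exists L : {linear E -> E}, (forall x, Dom S x -> L x = V x) /\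
    forall x, nrm (L x) <= M * nrm x.
Proof.
move=> M0 VD VZ VM; have [_ _ dS _ _] := regS.
have VB x y : Dom S x -> Dom S y -> nrm (V x - V y) <= M * nrm (x - y).
  move=> Sx Sy; rewrite -[- V y]scaleN1r -VZ // -VD ?scaleN1r; last exact: domN.
    by apply: VM; exact: domB.
  by [].
have M1 : 0 < M + 1 by rewrite ltr_wpDl.
have /choice[g gP] x : exists v, forall u, Dom S u ->
    nrm (V u - v) <= (M + 1) * nrm (u - x).
  have [||v vP] := @complete_approx R E (fun e v => exists u,
      [/\ Dom S u, (M + 1) * nrm (u - x) <= e & v = V u]).
  - move=> e e0; have [u Su ux] := dense_approx x dS (divr_gt0 e0 M1).
    by exists (V u), u; split=> //; rewrite mulrC -ler_pdivlMr.
  - move=> e d _ _ [u [Su ux ->]] [w [Sw wx ->]].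
    rewrite (le_trans (VB _ _ Su Sw)) //.
    apply: le_trans (_ : (M + 1) * (nrm (u - x) + nrm (w - x)) <= _).
      apply: ler_pM => //; rewrite ?nrm_ge0 ?lerDl //.
      have -> : u - w = (u - x) - (w - x) by rewrite opprB addrA subrK.
      exact: nrmB.
    by rewrite mulrDr lerD.
  by exists v => u Su; apply: vP; exists u.
have gV x : Dom S x -> g x = V x.
  move=> Sx; apply/eqP; rewrite eq_sym -subr_eq0; apply/eqP/nrm_eq0/le_anti.
  by rewrite nrm_ge0 andbT (le_trans (gP _ _ Sx)) // subrr nrm0 mulr0.
have eq0 z : (forall e, 0 < e -> nrm z <= (M + 1) * e) -> z = 0.
  move=> H; apply/nrm_eq0/le_anti; rewrite nrm_ge0 andbT.
  by apply: (ler_addgt0M (M + 1)); rewrite ?ltW // => e /H; rewrite add0r.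
have glin : linear g.
  move=> a x y; apply/eqP; rewrite -subr_eq0; apply/eqP/eq0 => e e0.
  (* The three errors below add up to [(M + 1) * 2 (|a| + 1) d]. *)
  pose d := e / (2 * (nrm a + 2)).
  have a2 : 0 < nrm a + 2 by rewrite ltr_wpDl ?nrm_ge0.
  have d0 : 0 < d by rewrite divr_gt0 // mulr_gt0.
  have [u Su ux] := dense_approx x dS d0.
  have [w Sw wx] := dense_approx y dS d0.
  have Saw : Dom S (a *: u + w) by apply: domD => //; apply: domZ.
  have -> : g (a *: x + y) - (a *: g x + g y) =
      a *: (V u - g x) + (V w - g y) - (V (a *: u + w) - g (a *: x + y)).
    rewrite VD ?VZ //; last exact: domZ.
    rewrite scalerBr !opprD !opprK !addrA.
    by rewrite [RHS](ACl (7*2*4*(1*5)*(3*6))%AC) /= !subrr !addr0.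
  have h1 := gP x _ Su; have h2 := gP y _ Sw; have h3 := gP (a *: x + y) _ Saw.
  have h4 : nrm (a *: u + w - (a *: x + y)) <= nrm a * d + d.
    rewrite opprD addrACA -scalerBr (le_trans (nrmD _ _)) // nrmZ.
    by rewrite lerD // ler_wpM2l ?nrm_ge0.
  rewrite (le_trans (nrmB _ _)) // (le_trans (lerD (nrmD _ _) (lexx _))) // nrmZ.
  have k1 : nrm a * nrm (V u - g x) <= nrm a * ((M + 1) * d).
    by rewrite ler_wpM2l ?nrm_ge0 // (le_trans h1) // ler_pM2l.
  have k2 : nrm (V w - g y) <= (M + 1) * d by rewrite (le_trans h2) // ler_pM2l.
  have k3 : nrm (V (a *: u + w) - g (a *: x + y)) <= (M + 1) * (nrm a * d + d).
    by rewrite (le_trans h3) // ler_pM2l.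
  rewrite (le_trans (lerD (lerD k1 k2) k3)) //.
  have -> : nrm a * ((M + 1) * d) + (M + 1) * d + (M + 1) * (nrm a * d + d) =
     (M + 1) * (d * (2 * (nrm a + 1))) by ring.
  rewrite ler_pM2l // /d mulrAC ler_pdivrMr ?mulr_gt0 // ler_pM2l //.
  lra.
have [L LE] := linear_exists glin.
exists L; split=> x; first by move=> Sx; rewrite LE gV.
rewrite LE; apply: (ler_addgt0M (M + (M + 1))) => [|e e0].
  by rewrite addr_ge0 // ltW.
have [u Su ux] := dense_approx x dS e0.
have -> : g x = V u - (V u - g x) by rewrite subKr.
rewrite (le_trans (nrmB _ _)) // mulrDl addrA lerD //.
  rewrite (le_trans (VM _ Su)) // -mulrDr ler_wpM2l //.
  have -> : u = x + (u - x) by rewrite addrC subrK.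
  by rewrite (le_trans (nrmD _ _)) // lerD.
by rewrite (le_trans (gP _ _ Su)) // ler_pM2l.
Qed.

Lemma imaginaryE l : imaginary l -> l = imag (complex.Im l).
Proof. by rewrite /imaginary; case: l => a b /= ->. Qed.

(** The uniform bound yields the extensions and carries the convergence from the dense domain to all
    of [E]. *)
Lemma strongly_null_of_dense (l0 M : R) (A : R[i] -> partialOp E) :
  0 <= M ->
  (forall m, l0 <= `|m| ->
     [/\ Dom (A (imag m)) = Dom S,
         forall x y, Dom S x -> Dom S y ->
           A (imag m) (x + y) = A (imag m) x + A (imag m) y,
         forall l x, Dom S x -> A (imag m) (l *: x) = l *: A (imag m) x &
         forall x, Dom S x -> nrm (A (imag m) x) <= M * nrm x]) ->
  (forall x e, Dom S x -> 0 < e -> exists N : R, forall m, N <= `|m| ->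
     l0 <= `|m| -> nrm (A (imag m) x) <= e) ->
  bounded_strongly_null l0 (Dom S) A.
Proof.
move=> M0 AP A0; have [_ _ dS _ _] := regS.
have /choice[L LP] l : exists L : {linear E -> E}, forall m, l = imag m ->
    l0 <= `|m| -> (forall x, Dom S x -> L x = A l x) /\
    forall x, nrm (L x) <= M * nrm x.
  case: (pselect (exists2 m, l = imag m & l0 <= `|m|)) => [[m -> lm]|H].
    have [_ AD AZ AM] := AP _ lm; have [L LP] := extend_bounded M0 AD AZ AM.
    by exists L => _ _ _.
  (* For the remaining [l] nothing is asked of the extension, and zero is a default value. *)
  by exists \0 => m lm lm0; case: H; exists m.
have lI l : imaginary l -> l0%:C <= `|l| ->
    l = imag (complex.Im l) /\ l0 <= `|complex.Im l|.
  move=> /imaginaryE lE H; split=> //.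
  by move: H; rewrite lE normE nrm_imag lecR.
have null x e : 0 < e -> exists N : R, forall m, N <= `|m| ->
    nrm (L (imag m) x) <= e.
  move=> e0; have M1 : 0 < M + 1 by rewrite ltr_wpDl.
  have e2 : 0 < e / 2 by rewrite divr_gt0.
  have [u Su ux] := dense_approx x dS (divr_gt0 e2 M1).
  have [N NP] := A0 u _ Su e2.
  exists (Num.max N l0) => m; rewrite ge_max => /andP[Nm lm].
  have [LA LM] := LP _ m erefl lm.
  have -> : x = u - (u - x) by rewrite subKr.
  rewrite linearB LA // (le_trans (nrmB _ _)) // [e]splitr lerD ?NP //.
  rewrite (le_trans (LM _)) // (le_trans (ler_wpM2l M0 ux)) //.
  rewrite mulrCA -[leRHS]mulr1 ler_wpM2l ?(ltW e2) // ler_pdivrMr // mul1r.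
  by rewrite lerDl.
exists L; split.
- move=> l il ll; have [lE lm] := lI _ il ll.
  have [DA _ _ _] := AP _ lm; have [LA LM] := LP _ _ lE lm.
  split; first by rewrite lE.
  split=> [x Dx|]; first by apply: LA; rewrite -DA -lE.
  by exists M => x; rewrite !normE -rmorphM lecR.
- exists M => l il ll x; have [lE lm] := lI _ il ll.
  by have [_ LM] := LP _ _ lE lm; rewrite !normE -rmorphM lecR.
- move=> x; apply/cvgrPdist_le => e /posCE[r r0 ->].
  have [N NP] := null x r r0; near=> m.
  rewrite sub0r normrN normE lecR; apply: NP.
  by rewrite ger0_norm.
- move=> x; apply/cvgrPdist_le => e /posCE[r r0 ->].
  have [N NP] := null x r r0; near=> m.
  rewrite sub0r normrN normE lecR; apply: NP.
  by rewrite -normrN ger0_norm // lerNr.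
Unshelve. all: by end_near. Qed.

End StrongNullity.

(** Iteration gives [d (1 + 1/2 + 1/4 + ...) = 2 d], and the a priori constant [K], however large,
    contributes only [K / 2^n]. *)
Lemma halving_bound (R : realType) (E : normedZmodType R[i]) (f : E -> R) (K d : R) :
  0 <= K -> 0 <= d -> (forall v, f v <= K * nrm v) ->
  (forall v, exists2 z, nrm z <= nrm v / 2 & f v <= d * nrm v + f z) ->
  forall v, f v <= 2 * d * nrm v.
Proof.
move=> K0 d0 fK fP v.
have H n u : f u <= (2 * d + K / 2 ^+ n) * nrm u.
  elim: n u => [|n IH] u.
    by rewrite (le_trans (fK u)) // ler_wpM2r ?nrm_ge0 // expr0 divr1 lerDr mulr_ge0.
  have [z zu /le_trans] := fP u; apply.
  have q0 : 0 <= 2 * d + K / 2 ^+ n by rewrite addr_ge0 ?mulr_ge0 ?divr_ge0 ?exprn_ge0.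
  have := le_trans (IH z) (ler_wpM2l q0 zu).
  have -> : K / 2 ^+ n.+1 = K / 2 ^+ n / 2 by rewrite exprS invfM mulrCA mulrC.
  set q := K / _; lra.
apply: (ler_addgt0M (K * nrm v)) => [|e e0]; first by rewrite mulr_ge0 ?nrm_ge0.
have := archi_boundP (x := e^-1); rewrite invr_ge0 (ltW e0) => /(_ isT).
set n := Num.bound _ => ne; apply: le_trans (H n v) _.
rewrite mulrDl lerD2l mulrAC ler_wpM2l ?mulr_ge0 ?nrm_ge0 //.
have n2 : e^-1 <= 2 ^+ n by rewrite (le_trans (ltW ne)) // -natrX ler_nat ltnW // ltn_expl.
by rewrite -[leRHS]invrK lef_pV2 ?posrE ?exprn_gt0 ?invr_gt0.
Qed.

(** * Weakly commuting operators *)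

Section WeaklyCommuting.
Context {R : realType} {B : cstarAlgType R} {E : hilbertModType B}.
Variables S T : partialOp E.
Hypotheses (regS : regular S) (saS : self_adjoint S).
Hypotheses (regT : regular T) (saT : self_adjoint T).
Implicit Types (x y z u v w : E) (l : R[i]) (m e : R).

Lemma core_approx (D : set E) x e : is_core D T -> Dom T x -> 0 < e ->
  exists u, [/\ D u, nrm (u - x) <= e & nrm (T u - T x) <= e].
Proof.
move=> [_ _ DT] Tx e0.
have : closure (pop_graph (pop_restr T D)) (x, T x) by rewrite DT.
have e0C : 0 < e%:C by rewrite real_complex_gt0.
move=> /(_ _ (nbhsx_ballx (x, T x) e%:C e0C)) [[u v] [[/= [_ Du] ->] [/= h1 h2]]].
by exists u; split=> //; rewrite nrmC -nrm_le ltW //; [move: h1|move: h2];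
  rewrite -ball_normE.
Qed.

(** A sum of squares is at most the square of the sum, and [C <= (C + 1)^2]. *)
Lemma commutator_bound (C : R) x : 0 < C ->
  cle (ip (commutator S T x) (commutator S T x)) (C%:C *: ip_ST S T x x) ->
  nrm (commutator S T x) <= (C + 1) * (nrm x + nrm (S x) + nrm (T x)).
Proof.
move=> C0 /(cle_nrm (ip_pos _)); rewrite ip_nrm nrmZ nrmR gtr0_norm // => H.
have sum : nrm (ip_ST S T x x) <= (nrm x + nrm (S x) + nrm (T x)) ^+ 2.
  rewrite /ip_ST (le_trans (nrmD _ _)) //.
  rewrite (le_trans (lerD (nrmD _ _) (lexx _))) // !ip_nrm.
  have := nrm_ge0 x; have := nrm_ge0 (S x); have := nrm_ge0 (T x); nra.
have s0 : 0 <= nrm x + nrm (S x) + nrm (T x) by rewrite !addr_ge0 ?nrm_ge0.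
have C1 : 0 <= C + 1 by rewrite addr_ge0 // ltW.
rewrite -ler_sqr ?nnegrE ?nrm_ge0 ?mulr_ge0 // (le_trans H) // exprMn.
apply: ler_pM => //; rewrite ?nrm_ge0 ?ltW //.
by nra.
Qed.

Section Core.
Variables (c l0 : R) (D : set E).
Hypotheses (c0 : 0 < c) (coreD : is_core D T).
Hypothesis commP : forall x, Dom (commutator S T) x ->
  nrm (commutator S T x) <= c * (nrm x + nrm (S x) + nrm (T x)).
Hypothesis coreDom : forall m, l0 <= `|m| -> forall u, D u ->
  Dom (commutator S T) (res S m u).

Let DD u v : D u -> D v -> D (u - v).
Proof.
move=> Du Dv; have [[_ DD DZ _] _ _] := coreD.
by rewrite -scaleN1r; apply: DD => //; apply: DZ.
Qed.

Section Fixed.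
Variable m : R.
Hypotheses (ml : l0 <= `|m|) (m1 : 1 <= `|m|) (mc : 2 * c <= `|m|).

Let mp : 0 < `|m|. Proof. exact: lt_le_trans m1. Qed.
Let m0 : m != 0. Proof. by rewrite -normr_gt0. Qed.
Local Notation P := (res S m).
Local Notation Q := (res T m).

(** For the identity, [S + i m] is applied to both sides and [T u = T S P u + i m T P u] is used.
    For the bound, [T P u = P T u + P z] gives [|T P u| <= (|T u| + |z|) / |m|]; since [2 c <= |m|],
    the term in [|z|] is absorbed on the left, which doubles [c]. *)
Lemma commutator_core u : D u ->
  [/\ Dom T (P u), T (P u) - P (T u) = P (commutator S T (P u)) &
      nrm (commutator S T (P u)) <=
        2 * c * (nrm (P u) + nrm (S (P u)) + nrm (T u) / `|m|)].
Proof.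
move=> Du; have [_ DT _] := coreD; have Tu := DT _ Du.
have Z := coreDom ml Du; have [[TPu STPu] [SPu TSPu]] := Z.
have zE : T (P u) - P (T u) = P (commutator S T (P u)).
  apply/esym/(res_uniq regS saS m0).
    by apply: (domB regS) => //; apply: (res_dom regS saS m0).
  have SP := res_dom regS saS m0 (T u).
  have TSE : T (S (P u)) = T u - imag m *: T (P u).
    by rewrite (op_res regS saS m0 u) (opB regT Tu (domZ regT _ TPu)) (opZ regT _ TPu).
  rewrite (opB regS STPu SP) scalerBr addrACA -opprD (res_eq regS saS m0 (T u)).
  by rewrite /commutator /= TSE opprB addrA.
split=> //; move: (commP Z) zE; set z := commutator S T (P u) => zc zE.
have tE : T (P u) = P (T u) + P z by rewrite -zE addrC subrK.
have : `|m| * nrm (T (P u)) <= nrm (T u) + nrm z.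
  rewrite tE (le_trans (ler_wpM2l (ltW mp) (nrmD _ _))) // mulrDr.
  by rewrite lerD // (nrm_res regS saS m0).
rewrite mulrC -ler_pdivlMr // mulrDl => tz.
have cz : c * (nrm z / `|m|) <= nrm z / 2.
  rewrite mulrCA ler_wpM2l ?nrm_ge0 // ler_pdivrMr // mulrC ler_pdivlMr //.
  by rewrite mulrC.
have : c * nrm (T (P u)) <= c * (nrm (T u) / `|m|) + c * (nrm z / `|m|).
  by rewrite -mulrDr ler_pM2l.
move: zc cz; rewrite !mulrDr.
set q := _ / `|m|; set q' := _ / `|m|; lra.
Qed.

Lemma commutator_coreB u v : D u -> D v ->
  commutator S T (P u) - commutator S T (P v) = commutator S T (P (u - v)).
Proof.
move=> Du Dv.
have [[Tu STu] [Su TSu]] := coreDom ml Du; have [[Tv STv] [Sv TSv]] := coreDom ml Dv.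
rewrite (resB regS saS m0) /commutator /=.
rewrite (opB regT Tu Tv) (opB regS STu STv) (opB regS Su Sv) (opB regT TSu TSv).
by rewrite !opprD !opprK !addrA [LHS](ACl (1*3*2*4)%AC).
Qed.

(* [z] is the closure of [[S, T] (S + l)^-1] applied to [x]. *)
Lemma res_commutator x : Dom T x -> exists z,
  [/\ Dom T (P x), T (P x) - P (T x) = P z &
      nrm z <= 2 * c * (nrm (P x) + nrm (S (P x)) + nrm (T x) / `|m|)].
Proof.
move=> Tx; have [_ DT _] := coreD.
pose W u := commutator S T (P u).
(* [W] is bounded with this constant for the graph norm of [T], in which the core is dense in
   [Dom T]. *)
pose k := 4 * c; have k0 : 0 < k by rewrite mulr_gt0.
have Pm v : nrm (P v) <= nrm v.
  rewrite (le_trans _ (nrm_res regS saS m0 v)) // ler_peMl ?nrm_ge0 //.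
have WD d : D d -> nrm (W d) <= k * (nrm d + nrm (T d)).
  move=> Dd; have [_ _ Wd] := commutator_core Dd.
  rewrite (le_trans Wd) // /k.
  have h1 := Pm d; have h2 := nrm_op_res regS saS m0 d.
  have h3 : nrm (T d) / `|m| <= nrm (T d).
    by rewrite ler_pdivrMr // ler_peMr ?nrm_ge0.
  have -> : 4 * c * (nrm d + nrm (T d)) = 2 * c * (2 * (nrm d + nrm (T d))) by ring.
  rewrite ler_pM2l ?mulr_gt0 //.
  have := nrm_ge0 (T d); move: h3; set q := _ / `|m|; lra.
have WB u v : D u -> D v ->
    nrm (W u - W v) <= k * (nrm (u - x) + nrm (T u - T x)) +
                       k * (nrm (v - x) + nrm (T v - T x)).
  move=> Du Dv; rewrite /W commutator_coreB // (le_trans (WD _ (DD Du Dv))) //.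
  rewrite -mulrDr ler_pM2l // (opB regT (DT _ Du) (DT _ Dv)).
  have -> : u - v = (u - x) - (v - x) by rewrite opprB addrA subrK.
  have -> : T u - T v = (T u - T x) - (T v - T x) by rewrite opprB addrA subrK.
  by rewrite addrACA lerD ?nrmB.
have near_x e : 0 < e ->
    exists u, [/\ D u, nrm (u - x) <= e, nrm (T u - T x) <= e &
                  k * (nrm (u - x) + nrm (T u - T x)) <= e].
  move=> e0; pose d := Num.min e (e / (2 * k)).
  have d0 : 0 < d by rewrite lt_min e0 divr_gt0 // mulr_gt0.
  have [u [Du u1 u2]] := core_approx coreD Tx d0.
  have de : d <= e by rewrite ge_min lexx.
  exists u; split=> //; [exact: le_trans de|exact: le_trans de|].
  apply: le_trans (_ : k * (d + d) <= _); first by rewrite ler_pM2l // lerD.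
  have : d <= e / (2 * k) by rewrite ge_min lexx orbT.
  by rewrite ler_pdivlMr ?mulr_gt0 //; lra.
have [||z zP] := @complete_approx R E (fun e v => exists u,
    [/\ D u, k * (nrm (u - x) + nrm (T u - T x)) <= e & v = W u]).
- by move=> e e0; have [u [Du _ _ ue]] := near_x e e0; exists (W u), u.
- move=> e d _ _ [u [Du ue ->]] [v [Dv ve ->]].
  by rewrite (le_trans (WB _ _ Du Dv)) // lerD.
have zW u e : D u -> k * (nrm (u - x) + nrm (T u - T x)) <= e -> nrm (W u - z) <= e.
  by move=> Du ue; apply: zP; exists u.
have [TPx TPxE] : Dom T (P x) /\ T (P x) = P (T x) + P z.
  apply: (closed_op regT) => e e0.
  have e2 : 0 < e / 2 by rewrite divr_gt0.
  have [u [Du u1 u2 u3]] := near_x _ e2.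
  have [TPu uE _] := commutator_core Du.
  exists (P u); split=> //.
    rewrite -(resB regS saS m0) (le_trans (Pm _)) // (le_trans u1) //; lra.
  have -> : T (P u) = P (T u) + P (W u) by rewrite -uE addrC subrK.
  rewrite opprD addrACA -!(resB regS saS m0) (le_trans (nrmD _ _)) //.
  rewrite [e]splitr lerD // (le_trans (Pm _)) //.
  exact: zW.
exists z; split=> //; first by rewrite TPxE addrC addKr.
(* The total error is [6 c e + e], and [2 k = 8 c]. *)
apply: (ler_addgt0M (2 * k + 1)) => [|e e0]; first by rewrite addr_ge0 // mulr_ge0 // ltW.
have [u [Du u1 u2 u3]] := near_x _ e0.
have [_ _ Wu] := commutator_core Du.
have -> : z = W u - (W u - z) by rewrite subKr.
rewrite (le_trans (nrmB _ _)) //.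
have h1 := zW _ _ Du u3.
have h2 : nrm (P u) <= nrm (P x) + e.
  have -> : u = x + (u - x) by rewrite addrC subrK.
  rewrite (resD regS saS m0) (le_trans (nrmD _ _)) // lerD //.
  by rewrite (le_trans (Pm _)).
have h3 : nrm (S (P u)) <= nrm (S (P x)) + e.
  have -> : u = x + (u - x) by rewrite addrC subrK.
  rewrite (resD regS saS m0).
  rewrite (opD regS (res_dom regS saS m0 _) (res_dom regS saS m0 _)).
  rewrite (le_trans (nrmD _ _)) // lerD //.
  by rewrite (le_trans (nrm_op_res regS saS m0 _)).
have h4 : nrm (T u) / `|m| <= nrm (T x) / `|m| + e.
  have -> : T u = T x + (T u - T x) by rewrite addrC subrK.
  rewrite ler_pdivrMr // mulrDl divfK ?gt_eqF // (le_trans (nrmD _ _)) // lerD //.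
  by rewrite (le_trans u2) // ler_peMr // ltW.
have h5 : nrm (W u) <= 2 * c * (nrm (P x) + nrm (S (P x)) + nrm (T x) / `|m| + 3 * e).
  rewrite (le_trans Wu) // ler_pM2l ?mulr_gt0 //.
  by move: h4; set q := _ / `|m|; set q' := _ / `|m|; lra.
have ke : 0 < k * e by rewrite mulr_gt0.
move: h5; rewrite /k in ke *; set q := _ / `|m|; lra.
Qed.

(** This is [res_commutator] at [Q y], multiplied by [|m|]. Replacing [i m Q y] by [y - T Q y] in
    [|m| |S P Q y|] makes every term on the right tend to zero as [|m|] grows. *)
Lemma res_res_commutator y : exists z,
  [/\ Dom T (P (Q y)), T (P (Q y)) - P (T (Q y)) = P z &
      `|m| * nrm z <= 2 * c * (nrm y / `|m| + nrm (S (P y)) + 2 * nrm (T (Q y)))].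
Proof.
have [z [TPQ zE zb]] := res_commutator (res_dom regT saT m0 y).
exists z; split=> //.
apply: le_trans (ler_wpM2l (ltW mp) zb) _.
rewrite mulrCA ler_pM2l ?mulr_gt0 // !mulrDr [`|m| * (_ / _)]mulrC divfK ?gt_eqF //.
have h1 : `|m| * nrm (P (Q y)) <= nrm y / `|m|.
  rewrite (le_trans (nrm_res regS saS m0 _)) // ler_pdivlMr // mulrC.
  exact: nrm_res.
have h2 : `|m| * nrm (S (P (Q y))) <= nrm (S (P y)) + nrm (T (Q y)).
  have Dy := res_dom regS saS m0 y; have DT := res_dom regS saS m0 (T (Q y)).
  rewrite -nrm_imag -nrmZ -(opZ regS _ (res_dom regS saS m0 _)) -(resZ regS saS m0).
  have -> : imag m *: Q y = y - T (Q y) by rewrite (op_res regT saT m0) subKr.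
  rewrite (resB regS saS m0) (opB regS Dy DT) (le_trans (nrmB _ _)) // lerD //.
  exact: nrm_op_res.
by move: h1; set q := _ / `|m|; lra.
Qed.

Lemma res_res_commutator_le y z :
  `|m| * nrm z <= 2 * c * (nrm y / `|m| + nrm (S (P y)) + 2 * nrm (T (Q y))) ->
  `|m| * nrm z <= 8 * c * nrm y.
Proof.
move=> H; apply: (le_trans H).
have -> : 8 * c * nrm y = 2 * c * (4 * nrm y) by ring.
rewrite ler_pM2l ?mulr_gt0 //.
have h1 : nrm y / `|m| <= nrm y by rewrite ler_pdivrMr // ler_peMr ?nrm_ge0.
have := nrm_op_res regS saS m0 y; have := nrm_op_res regT saT m0 y.
by move: h1; set q := _ / `|m|; lra.
Qed.

(** [T + i m] maps [P Q y] to [P y + P z]. *)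
Lemma res_swap y z : Dom T (P (Q y)) ->
  T (P (Q y)) - P (T (Q y)) = P z -> P (Q y) = Q (P y) + Q (P z).
Proof.
move=> TPQ zE; rewrite -(resD regT saT m0); apply/esym/(res_uniq regT saT m0) => //.
have -> : T (P (Q y)) = P (T (Q y)) + P z by rewrite -zE addrC subrK.
rewrite addrAC -(resZ regS saS m0) -(resD regS saS m0 (T (Q y))).
by rewrite (res_eq regT saT m0).
Qed.

Definition res_comm w := S (P (Q w)) - P (Q (S w)).

Lemma res_commE w : Dom S w ->
  res_comm w = Q (P (S w + imag m *: w)) - P (Q (S w + imag m *: w)).
Proof.
move=> Sw; rewrite (res_uniq regS saS m0 Sw erefl) /res_comm (op_res regS saS m0).
rewrite (resD regT saT m0) (resZ regT saT m0) (resD regS saS m0) (resZ regS saS m0).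
by rewrite opprD addrA addrAC.
Qed.

End Fixed.

Lemma nrm_res_comm m w : l0 <= `|m| -> 1 <= `|m| -> 16 * c <= `|m| -> Dom S w ->
  `|m| ^+ 2 * nrm (res_comm m w) <= 64 * c * nrm w.
Proof.
move=> ml m1 mc Sw.
have mp : 0 < `|m| by apply: lt_le_trans m1.
have m0 : m != 0 by rewrite -normr_gt0.
have m0' : - m != 0 by rewrite oppr_eq0.
have ml' : l0 <= `|- m| by rewrite normrN.
have m1' : 1 <= `|- m| by rewrite normrN.
have mc' : 2 * c <= `|- m| by rewrite normrN; have := c0; lra.
pose y := S w + imag m *: w.
have Py : res S m y = w by apply: res_uniq.
(* The adjoint of [Q P - P Q], formed with the resolvents at [- m]. *)
pose F v := res S (- m) (res T (- m) v) - res T (- m) (res S (- m) v).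
have adj v : ip (res_comm m w) v = ip y (F v).
  rewrite (res_commE m1 Sw) ipBl ipBr -/y.
  by rewrite (res_adj regT saT _ _ m0) !(res_adj regS saS _ _ m0) (res_adj regT saT _ _ m0).
have Pm (A : partialOp E) (rA : regular A) (sA : self_adjoint A) v :
    nrm (res A (- m) v) <= nrm v.
  by rewrite (le_trans _ (nrm_res rA sA m0' v)) // ler_peMl ?nrm_ge0.
have bound v : nrm (ip y (F v)) <= 2 * (32 * c / `|m| ^+ 2 * nrm w) * nrm v.
  (* The a priori constant is [4 * 2 |y|], from [ip_nrm_le] and [|F u| <= 2 |u|]. *)
  apply: (@halving_bound _ _ (fun v => nrm (ip y (F v))) (8 * nrm y)) => [|||u].
  - by rewrite mulr_ge0 ?nrm_ge0.
  - by rewrite mulr_ge0 ?nrm_ge0 // divr_ge0 ?mulr_ge0 ?sqr_ge0 // ltW.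
  - move=> u; rewrite (le_trans (ip_nrm_le _ _)) //.
    have : nrm (F u) <= 2 * nrm u.
      rewrite (le_trans (nrmB _ _)) //.
      have := Pm S regS saS (res T (- m) u); have := Pm T regT saT u.
      have := Pm T regT saT (res S (- m) u); have := Pm S regS saS u.
      lra.
    by have := nrm_ge0 y; nra.
  - have [z [TPQ zE]] := res_res_commutator ml' m1' mc' u.
    move=> /(res_res_commutator_le m1'); rewrite normrN => zu.
    exists z.
      (* [|z| <= |u| / 2] because [8 c |u| <= |m| |u| / 2]. *)
      rewrite -(ler_pM2l mp) (le_trans zu) //.
      by have := nrm_ge0 u; move: mc; nra.
    (* [res_swap] gives [F u] with the resolvent of [T] outermost. Exchanging the two costs [- F z],
       but then the resolvent of [S] can move across the inner product and turn [y] into [w]. *)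
    have Fu : F u = res S (- m) (res T (- m) z) - F z.
      have sw := res_swap m1' TPQ zE.
      by rewrite /F sw addrC addKr opprB addrC subrK.
    rewrite Fu ipBr (le_trans (nrmB _ _)) // lerD2r.
    rewrite -(res_adj regS saS _ _ m0) Py (le_trans (ip_nrm_le _ _)) //.
    have Qz := nrm_res regT saT m0' z; rewrite normrN in Qz.
    have m2 : 0 < `|m| ^+ 2 by rewrite exprn_gt0.
    have H : `|m| ^+ 2 * nrm (res T (- m) z) <= 8 * c * nrm u.
      by rewrite expr2 -mulrA (le_trans (ler_wpM2l (ltW mp) Qz)).
    have -> : 32 * c / `|m| ^+ 2 * nrm w * nrm u =
       4 * (nrm w * (8 * c * nrm u / `|m| ^+ 2)) by field; rewrite gt_eqF.
    rewrite ler_pM2l // ler_wpM2l ?nrm_ge0 // ler_pdivlMr // mulrC //.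
(* Testing on [res_comm m w] itself turns the bound of the functional into a bound of its norm. *)
have := bound (res_comm m w); rewrite -adj ip_nrm expr2.
have [v0|v0] := eqVneq (nrm (res_comm m w)) 0.
  by move=> _; rewrite v0 mulr0 !mulr_ge0 ?nrm_ge0 // ltW.
rewrite ler_pM2r; last by rewrite lt_neqAle eq_sym v0 nrm_ge0.
have m2 : 0 < `|m| ^+ 2 by rewrite exprn_gt0.
rewrite -(ler_pM2l m2) => /le_trans; apply.
rewrite le_eqVlt; apply/orP; left; apply/eqP; field.
by rewrite gt_eqF.
Qed.

(** The vector [S w + i m w] is split. On [S w] the bound [8 c] leaves a factor [1 / |m|]; on [w]
    the extra factor [|m|] is compensated by the finer estimate of [res_res_commutator]. *)
Lemma nrm_res_comm_null m w : l0 <= `|m| -> 1 <= `|m| -> 2 * c <= `|m| -> Dom S w ->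
  `|m| ^+ 2 * nrm (res_comm m w) <= 8 * c * nrm (S w) / `|m| +
    2 * c * (nrm w / `|m| + nrm (S (res S m w)) + 2 * nrm (T (res T m w))).
Proof.
move=> ml m1 mc Sw.
have mp : 0 < `|m| by apply: lt_le_trans m1.
have m0 : m != 0 by rewrite -normr_gt0.
have QP v : `|m| ^+ 2 * nrm (res T m (res S m v)) <= nrm v.
  rewrite expr2 -mulrA (le_trans _ (nrm_res regS saS m0 _)) // ler_pM2l //.
  exact: nrm_res.
have [z1 [TPQ1 z1E /(res_res_commutator_le m1) z1b]] := res_res_commutator ml m1 mc (S w).
have [z2 [TPQ2 z2E z2b]] := res_res_commutator ml m1 mc w.
have sw1 := res_swap m1 TPQ1 z1E; have sw2 := res_swap m1 TPQ2 z2E.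
have -> : res_comm m w = - (res T m (res S m z1) + imag m *: res T m (res S m z2)).
  rewrite (res_commE m1 Sw).
  rewrite (resD regS saS m0) (resD regT saT m0) (resZ regS saS m0) (resZ regT saT m0).
  rewrite (resD regT saT m0) (resD regS saS m0) (resZ regT saT m0) (resZ regS saS m0).
  by rewrite sw1 sw2 scalerDr [X in _ - X]addrACA opprD addrA subrr sub0r.
rewrite nrmN.
apply: le_trans (ler_wpM2l (sqr_ge0 _) (nrmD _ _)) _; rewrite mulrDr lerD //.
  by rewrite (le_trans (QP _)) // ler_pdivlMr // mulrC.
by rewrite nrmZ nrm_imag mulrCA (le_trans (ler_wpM2l (ltW mp) (QP _))).
Qed.

(** * The two scaled commutators *)

Lemma dom_comp_res m u : m != 0 ->
  Dom (pop_comp (resolvent S (imag m)) (resolvent T (imag m))) u.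
Proof.
by move=> m0; split; [rewrite (res_dom_resolvent regT saT m0)|
                      rewrite (res_dom_resolvent regS saS m0)].
Qed.

Lemma bounded_null_comm_S : bounded_strongly_null (`|l0| + 1 + 16 * c) (Dom S)
  (fun l => pop_scale (l ^+ 2)
     (commutator S (pop_comp (resolvent S l) (resolvent T l)))).
Proof.
have good m : `|l0| + 1 + 16 * c <= `|m| ->
    [/\ l0 <= `|m|, 1 <= `|m|, 16 * c <= `|m| & 2 * c <= `|m|].
  by move=> H; have := ler_norm l0; have := normr_ge0 l0; have := c0; split; lra.
apply: (strongly_null_of_dense regS (M := 64 * c)).
- by rewrite mulr_ge0 // ltW.
- move=> m /good[ml m1 mc mc2]; have m0 : m != 0 by rewrite -normr_gt0 (lt_le_trans _ m1).
  have AE w : pop_scale (imag m ^+ 2) (commutator S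
      (pop_comp (resolvent S (imag m)) (resolvent T (imag m)))) w =
      imag m ^+ 2 *: res_comm m w by [].
  have DSP u := res_dom regS saS m0 u.
  split.
  - apply/seteqP; split=> [w [_ [Sw _]] //|w Sw].
    by split; split=> //; [exact: dom_comp_res|exact: DSP|exact: dom_comp_res].
  - move=> x y Sx Sy; rewrite !AE -scalerDr /res_comm; congr (_ *: _).
    rewrite (resD regT saT m0) (resD regS saS m0) (opD regS (DSP _) (DSP _)).
    rewrite (opD regS Sx Sy) (resD regT saT m0) (resD regS saS m0).
    by rewrite opprD addrACA.
  - move=> l x Sx; rewrite !AE [RHS]scalerA [l * _]mulrC -[RHS]scalerA; congr (_ *: _).
    rewrite /res_comm (opZ regS _ Sx) !(resZ regT saT m0) !(resZ regS saS m0).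
    by rewrite (opZ regS _ (DSP _)) scalerBr.
  - move=> x Sx; rewrite AE nrmZ imag_sqr nrmR normrN normrX.
    exact: nrm_res_comm.
- move=> w e Sw e0.
  (* [K / |m|] collects the terms of order [1 / |m|]; the others get
     [2 c (1 + 2) e / (12 c) = e / 2]. *)
  pose K := 8 * c * nrm (S w) + 2 * c * nrm w.
  have K0 : 0 <= K by rewrite addr_ge0 ?mulr_ge0 ?nrm_ge0 // ltW.
  have e2 : 0 < e / 2 by rewrite divr_gt0.
  have ec : 0 < e / (12 * c) by rewrite divr_gt0 // mulr_gt0.
  have [N1 _ N1P] := op_res_cvg0 regS saS w ec.
  have [N2 _ N2P] := op_res_cvg0 regT saT w ec.
  exists (Num.max (Num.max N1 N2) (2 * K / e)) => m.
  rewrite !ge_max => /andP[/andP[/N1P h1 /N2P h2] mK] /good[ml m1 mc mc2].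
  have mp : 0 < `|m| by apply: lt_le_trans m1.
  have -> : pop_scale (imag m ^+ 2) (commutator S
      (pop_comp (resolvent S (imag m)) (resolvent T (imag m)))) w =
      imag m ^+ 2 *: res_comm m w by [].
  rewrite nrmZ imag_sqr nrmR normrN normrX.
  rewrite (le_trans (nrm_res_comm_null ml m1 mc2 Sw)) //.
  have h3 : 8 * c * nrm (S w) / `|m| + 2 * c * (nrm w / `|m|) <= e / 2.
    have -> : 8 * c * nrm (S w) / `|m| + 2 * c * (nrm w / `|m|) = K / `|m|.
      by rewrite /K; field; rewrite gt_eqF.
    rewrite ler_pdivrMr // mulrAC ler_pdivlMr // [leLHS]mulrC [leRHS]mulrC.
    by rewrite -ler_pdivrMr.
  have h4 : 2 * c * (nrm (S (res S m w)) + 2 * nrm (T (res T m w))) <= e / 2.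
    have -> : e / 2 = 2 * c * (e / (12 * c) + 2 * (e / (12 * c))).
      by field; rewrite gt_eqF.
    by rewrite ler_pM2l ?mulr_gt0 // lerD // ler_pM2l.
  move: h3 h4; rewrite !mulrDr; set q := _ / `|m|; set q' := 2 * c * (_ / `|m|); lra.
Qed.

(** On [Dom T] the resolvent [Q] commutes with [T], so the commutator is [P z]. One factor [|m|] is
    absorbed by [P] and the other by the estimate of [|m| |z|]. *)
Lemma bounded_null_comm_T : bounded_strongly_null (`|l0| + 1 + 16 * c) (Dom T)
  (fun l => pop_scale (l ^+ 2)
     (commutator T (pop_comp (resolvent S l) (resolvent T l)))).
Proof.
have good m : `|l0| + 1 + 16 * c <= `|m| ->
    [/\ l0 <= `|m|, 1 <= `|m|, 0 < `|m| & 2 * c <= `|m|].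
  by move=> H; have := ler_norm l0; have := normr_ge0 l0; have := c0; split; lra.
pose A m w := T (res S m (res T m w)) - res S m (res T m (T w)).
have AE m w : pop_scale (imag m ^+ 2) (commutator T
      (pop_comp (resolvent S (imag m)) (resolvent T (imag m)))) w =
      imag m ^+ 2 *: A m w by [].
have AP m w : l0 <= `|m| -> 1 <= `|m| -> 2 * c <= `|m| -> Dom T w ->
    exists2 z : E, `|m| ^+ 2 * nrm (A m w) <= `|m| * nrm z &
      `|m| * nrm z <= 2 * c * (nrm w / `|m| + nrm (S (res S m w)) +
                               2 * nrm (T (res T m w))).
  move=> ml m1 mc Tw; have mp : 0 < `|m| by apply: lt_le_trans m1.
  have m0 : m != 0 by rewrite -normr_gt0.
  have [z [_ zE zb]] := res_res_commutator ml m1 mc w; exists z => //.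
  rewrite /A (res_op regT saT m0 Tw) zE expr2 -mulrA ler_pM2l //.
  exact: nrm_res.
apply: (strongly_null_of_dense regT (M := 8 * c)).
- by rewrite mulr_ge0 // ltW.
- move=> m /good[ml m1 mp mc]; have m0 : m != 0 by rewrite -normr_gt0.
  have DT u : Dom T (res S m (res T m u)).
    by have [z []] := res_res_commutator ml m1 mc u.
  split.
  - apply/seteqP; split=> [w [_ [Tw _]] //|w Tw].
    by split; split=> //; [exact: dom_comp_res|exact: DT|exact: dom_comp_res].
  - move=> x y Tx Ty; rewrite !AE -scalerDr /A; congr (_ *: _).
    rewrite (opD regT Tx Ty) !(resD regT saT m0) !(resD regS saS m0).
    by rewrite (opD regT (DT _) (DT _)) opprD addrACA.
  - move=> l x Tx; rewrite !AE [RHS]scalerA [l * _]mulrC -[RHS]scalerA; congr (_ *: _).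
    rewrite /A (opZ regT _ Tx) !(resZ regT saT m0) !(resZ regS saS m0).
    by rewrite (opZ regT _ (DT _)) scalerBr.
  - move=> x Tx; rewrite AE nrmZ imag_sqr nrmR normrN normrX.
    have [z zA zb] := AP _ _ ml m1 mc Tx.
    by rewrite (le_trans zA) // (res_res_commutator_le m1 zb).
- move=> w e Tw e0.
  (* Four such errors, weighted by [2 c], make up [e]. *)
  have ec : 0 < e / (8 * c) by rewrite divr_gt0 // mulr_gt0.
  have [N1 _ N1P] := op_res_cvg0 regS saS w ec.
  have [N2 _ N2P] := op_res_cvg0 regT saT w ec.
  exists (Num.max (Num.max N1 N2) (nrm w / (e / (8 * c)))) => m.
  rewrite !ge_max => /andP[/andP[/N1P h1 /N2P h2] mK] /good[ml m1 mp mc].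
  rewrite AE nrmZ imag_sqr nrmR normrN normrX.
  have [z zA zb] := AP _ _ ml m1 mc Tw.
  rewrite (le_trans zA) // (le_trans zb) //.
  have -> : e = 2 * c * (e / (8 * c) + e / (8 * c) + 2 * (e / (8 * c))).
    by field; rewrite gt_eqF.
  rewrite ler_pM2l ?mulr_gt0 // !lerD // ?ler_pM2l //.
  by rewrite ler_pdivrMr // mulrC -ler_pdivrMr.
Qed.

End Core.
End WeaklyCommuting.

Theorem proposition2p3 (R : realType) (B : cstarAlgType R)
  (E : hilbertModType B) (S T : partialOp E)
  (regS : regular S) (saS : self_adjoint S)
  (regT : regular T) (saT : self_adjoint T)
  (denseST : dense (Dom S `&` Dom T))
  (wcST : weakly_commuting S T) :
  exists2 l0 : R, 0 < l0 &
    bounded_strongly_null l0 (Dom S)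
      (fun l => pop_scale (l ^+ 2)
         (commutator S (pop_comp (resolvent S l) (resolvent T l)))) /\
    bounded_strongly_null l0 (Dom T)
      (fun l => pop_scale (l ^+ 2)
         (commutator T (pop_comp (resolvent S l) (resolvent T l)))).
Proof.
have [[C C0 commC] [D [l0 [coreD l00 resD]]]] := wcST.
have c0 : 0 < C + 1 by rewrite addr_gt0.
have commP x : Dom (commutator S T) x ->
    nrm (commutator S T x) <= (C + 1) * (nrm x + nrm (S x) + nrm (T x)).
  by move=> /commC; apply: commutator_bound.
have coreDom m : l0 <= `|m| -> forall u, D u -> Dom (commutator S T) (res S m u).
  move=> lm u Du; apply: (resD (imag m)); last by exists u.
    by [].
  by rewrite normE nrm_imag lecR.
exists (`|l0| + 1 + 16 * (C + 1)).
  by rewrite ltr_wpDl ?mulr_gt0 // addr_ge0.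
split.
  exact: (bounded_null_comm_S regS saS regT saT c0 coreD commP coreDom).
exact: (bounded_null_comm_T regS saS regT saT c0 coreD commP coreDom).
Qed.
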